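(* Let $\mathbb{G}$ be a homogeneous Lie group with a quasi-norm $|\cdot|$ and homogeneous dimension $Q$. Let $1<p_1,p_2<\infty$, let $1<\max(p_1,p_2)\le q<\infty$ and let $\alpha,\beta_1,\beta_2\in\mathbb{R}$. Then the inequality $$\left(\int_{\mathbb{G}}\left(H_2^B(|f_1|,|f_2|)(x)\right)^q|x|^{\alpha}\,dx\right)^{1/q}\le C\left(\int_{\mathbb{G}}|f_1(x)|^{p_1}|x|^{\beta_1}\,dx\right)^{1/p_1}\left(\int_{\mathbb{G}}|f_2(x)|^{p_2}|x|^{\beta_2}\,dx\right)^{1/p_2}$$ holds (with some finite constant $C$) for all measurable functions $f_1,f_2:\mathbb{G}\to\mathbb{C}$ if and only if $$\alpha+Q<0,\qquad \beta_1(1-p_1')+Q>0,\qquad \beta_2(1-p_2')+Q>0$$ and $$\frac{\alpha+Q}{q}+\frac{\beta_1(1-p_1')+Q}{p_1'}+\frac{\beta_2(1-p_2')+Q}{p_2'}=0 .$$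
   Context: Here $dx$ is the Haar measure on $\mathbb{G}$, $p'$ is the conjugate exponent, $\frac1p+\frac1{p'}=1$, and the fixed point is the identity element $0$ of $\mathbb{G}$, with $B(0,r)=\{y\in\mathbb{G}:|y|<r\}$ the quasi-ball. For nonnegative measurable $g_1,g_2$ on $\mathbb{G}$, $$H_2^B(g_1,g_2)(x):=\int_{B(0,|x|)}g_1(y)\,dy\;\int_{B(0,|x|)}g_2(y)\,dy .$$ The polar decomposition on $\mathbb{G}$ has $\lambda(r,\omega)=r^{Q-1}$, i.e. $\int_{\mathbb{G}}g(x)\,dx=\int_0^\infty\int_{\{|\omega|=1\}}g(r,\omega)\,r^{Q-1}\,d\omega\,dr$. *)

(* Defs.v *)
From HB Require Import structures.
From mathcomp Require Import all_boot all_order all_algebra.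
From mathcomp Require Import all_classical all_reals all_analysis.
From mathcomp Require Import complex.

Set Implicit Arguments.
Unset Strict Implicit.
Unset Printing Implicit Defensive.

Import Order.TTheory GRing.Theory Num.Theory.
Import numFieldNormedType.Exports.

Local Open Scope classical_set_scope.
Local Open Scope ring_scope.

(* On finite-dimensional spaces, a map all of whose iterated directional
   derivatives up to order k exist and are continuous is exactly a C^k map. *)
Fixpoint class_C (R : realType) (V W : normedModType R) (k : nat)
    (f : V -> W) : Prop :=
  if k is k'.+1 then
    continuous f /\
    forall v : V, (forall x : V, derivable f x v) /\
                  class_C k' (fun x : V => 'D_v f x)
  else continuous f.

Definition smooth (R : realType) (V W : normedModType R) (f : V -> W) : Prop :=
  forall k : nat, class_C k f.

Definition dilation (R : realType) (n : nat) (nu : 'I_n -> R) (t : R)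
    (x : 'rV[R]_n) : 'rV[R]_n :=
  \row_i (t `^ nu i * x ord0 i).

(* A homogeneous Lie group is a Lie group on R^n whose (anisotropic) dilations
   are automorphisms; the identity element is then necessarily the origin. *)
Record homogeneousGroup (R : realType) (n : nat) := HomogeneousGroup {
  hmul : 'rV[R]_n -> 'rV[R]_n -> 'rV[R]_n ;
  hinv : 'rV[R]_n -> 'rV[R]_n ;
  hweight : 'I_n -> R ;
  hmulA : forall x y z, hmul x (hmul y z) = hmul (hmul x y) z ;
  hmul0g : forall x, hmul 0 x = x ;
  hmulg0 : forall x, hmul x 0 = x ;
  hmulVg : forall x, hmul (hinv x) x = 0 ;
  hmulgV : forall x, hmul x (hinv x) = 0 ;
  hmul_smooth :
    smooth (fun z : 'rV[R]_n * 'rV[R]_n => hmul z.1 z.2) ;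
  hinv_smooth : smooth hinv ;
  hweight_gt0 : forall i, 0 < hweight i ;
  hdilM : forall (t : R) x y, 0 < t ->
    dilation hweight t (hmul x y)
      = hmul (dilation hweight t x) (dilation hweight t y)
}.

Definition homogeneous_dim (R : realType) (n : nat)
    (G : homogeneousGroup R n) : R :=
  \sum_(i < n) hweight G i.

(* The pseudo-triangle inequality N (xy) <= c (N x + N y) is a consequence of
   these axioms, by compactness, and is therefore not listed. *)
Record is_quasinorm (R : realType) (n : nat) (G : homogeneousGroup R n)
    (N : 'rV[R]_n -> R) : Prop := IsQuasinorm {
  quasinorm_continuous : continuous N ;
  quasinorm_ge0 : forall x, 0 <= N x ;
  quasinorm_eq0 : forall x, N x = 0 <-> x = 0 ;
  quasinormV : forall x, N (hinv G x) = N x ;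
  quasinormZ : forall (t : R) x, 0 < t ->
    N (dilation (hweight G) t x) = t * N x
}.

Notation borelRV R n := (g_sigma_algebraType (@open 'rV[R]_n)).

(* Regularity is automatic for a Borel measure on R^n that is finite on compact
   sets, so this is the usual notion of a left Haar measure. *)
Record is_haar (R : realType) (n : nat) (G : homogeneousGroup R n)
    (mu : {measure set (borelRV R n) -> \bar R}) : Prop := IsHaar {
  haar_left_invariant : forall (x : 'rV[R]_n) (A : set (borelRV R n)),
    measurable A -> mu (hmul G x @` A) = mu A ;
  haar_compact : forall K : set 'rV[R]_n, compact K -> (mu K < +oo)%E ;
  haar_neq0 : mu setT <> 0%E
}.

Definition quasiball (R : realType) (n : nat) (N : 'rV[R]_n -> R) (r : R) :
    set 'rV[R]_n :=
  [set y | N y < r].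

Definition H2B (R : realType) (n : nat) (N : 'rV[R]_n -> R)
    (mu : {measure set (borelRV R n) -> \bar R})
    (g1 g2 : borelRV R n -> \bar R) (x : 'rV[R]_n) : \bar R :=
  ((\int[mu]_(y in quasiball N (N x)) g1 y) *
   (\int[mu]_(y in quasiball N (N x)) g2 y))%E.

Definition cmeasurable (R : realType) (n : nat) (f : borelRV R n -> R[i]) :
    Prop :=
  measurable_fun setT (fun x => complex.Re (f x)) /\
  measurable_fun setT (fun x => complex.Im (f x)).

Definition cmod (R : realType) (n : nat) (f : borelRV R n -> R[i])
    (x : borelRV R n) : \bar R :=
  (Normc.normc (f x))%:E.

(* Main.v *)
Require Import Defs.
From HB Require Import structures.
From mathcomp Require Import all_boot all_order all_algebra.
From mathcomp Require Import all_classical all_reals all_analysis.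
From mathcomp Require Import complex measurable_realfun.
From mathcomp Require Import ring lra zify.

Set Implicit Arguments.
Unset Strict Implicit.
Unset Printing Implicit Defensive.

Import Order.TTheory GRing.Theory Num.Theory.
Import numFieldNormedType.Exports.

Local Open Scope classical_set_scope.
Local Open Scope ring_scope.

(** Write [Q] for the homogeneous dimension, [B r] for the centered quasi-ball
    of radius [r], and [gamma_i = beta_i (1 - p_i')].

    The only geometric input is that Haar balls satisfy
    [a r^Q <= mu (B r) <= b r^Q] for all [r > 0] ([quasiball_volume]).
    It is obtained without uniqueness of the Haar measure and without comparing
    it to Lebesgue measure.  Since dilations are automorphisms and the group law
    is of class C^1, the group law is triangular for the ordering of coordinates
    by weight ([hmul_triangular]): increments of the law in a direction of
    weight [nu_j] scale like [t^nu_j], while its [i]-th coordinate scales like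
    [t^nu_i], so letting [t] tend to [0] replaces the increment at any point by
    the increment at the identity when [nu_i <= nu_j].  Solving coordinate by
    coordinate, the left translates of the cell with sides [e^nu_i] by the
    points of the lattice with the same mesh tile the group ([tile_exists],
    [tile_uniq]).  Counting tiles shows that a ball of radius [r] is covered by,
    and up to a constant factor contains, about [e^-Q] disjoint translates of a
    cell of size [r e] ([quasiball_cover], [quasiball_packing]), and left
    invariance turns the count into the volume estimate.

    The rest is analysis on a measure space with a function [N] whose sublevel
    sets have measure of the order of [r^Q].

    Necessity ([hardy_necessary]): the inequality is tested on the functions
    [N^gamma_i] restricted to a shell [s <= N < t], against points with
    [t <= N < u].  With [I_i] and [A] the integrals of [N^gamma_i] and of
    [N^alpha] over these two shells, this gives
    [I_1^(1/p_1') I_2^(1/p_2') A^(1/q) <= C].  Shells of fixed ratio at distance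
    [r] carry at least [c r^(gamma_i + Q)] and [c r^(alpha + Q)]; letting
    [s -> 0] or [u -> oo] forces the strict inequalities, and letting [r] vary
    over the positive reals forces the balance of the exponents.

    Sufficiency ([hardy_sufficient]): by Hoelder's inequality the integral of
    [f_i] over [B r] is at most [c |f_i| r^s_i] with [s_i = (gamma_i + Q)/p_i'].
    This bounds the factor coming from [f_2], and all but the power [p_1] of the
    factor coming from [f_1]; the balance of the exponents reduces the claim to
    the linear Hardy inequality with both exponents equal to [p_1]
    ([linear_hardy]), which follows from Hoelder's inequality with an auxiliary
    power weight and Tonelli's theorem. *)

(** * Dilations *)

Section dilations.
Context {R : realType} {n : nat} (nu : 'I_n -> R).
Implicit Types (x y : 'rV[R]_n) (s t : R).

Lemma dilationE t x i : dilation nu t x ord0 i = t `^ nu i * x ord0 i.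
Proof. by rewrite mxE. Qed.

Lemma dilationD t x y : dilation nu t (x + y) = dilation nu t x + dilation nu t y.
Proof. by apply/rowP => i; rewrite !mxE mulrDr. Qed.

Lemma dilation0 t : dilation nu t 0 = 0.
Proof. by apply/rowP => i; rewrite !mxE mulr0. Qed.

Lemma dilation1 x : dilation nu 1 x = x.
Proof. by apply/rowP => i; rewrite !mxE powR1 mul1r. Qed.

Lemma dilation_comp s t x : 0 <= s -> 0 <= t ->
  dilation nu s (dilation nu t x) = dilation nu (s * t) x.
Proof. by move=> s0 t0; apply/rowP => i; rewrite !mxE powRM// mulrA. Qed.

Lemma dilationK t : 0 < t -> cancel (dilation nu t) (dilation nu t^-1).
Proof.
by move=> t0 x; rewrite dilation_comp ?invr_ge0 ?ltW// mulVf ?dilation1// gt_eqF.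
Qed.

Lemma dilationVK t : 0 < t -> cancel (dilation nu t^-1) (dilation nu t).
Proof.
by move=> t0 x; rewrite dilation_comp ?invr_ge0 ?ltW// mulfV ?dilation1// gt_eqF.
Qed.

Lemma rV_norm_le x (e : R) : 0 <= e ->
  (`|x| <= e) <-> (forall i, `|x ord0 i| <= e).
Proof.
move=> e0; split=> [xe i|xe].
  apply: le_trans xe; rewrite [`|x|]mx_normrE.
  by have := le_bigmax 0 (fun i => `|x i.1 i.2|) (ord0, i).
rewrite [`|x|]mx_normrE; apply/bigmax_leP; split => // -[a b] _ /=.
by rewrite (ord1 a).
Qed.

Lemma rV_coord_norm x i : `|x ord0 i| <= `|x|.
Proof. by have /rV_norm_le : `|x| <= `|x| by []; apply; rewrite normr_ge0. Qed.

Hypothesis nu_gt0 : forall i, 0 < nu i.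

Lemma weight_lower_bound : exists2 m : R, 0 < m & forall i, m <= nu i.
Proof.
exists (\big[Num.min/1]_i nu i); last by move=> i; exact: bigmin_le_cond.
by apply/bigmin_gtP; split => // i _; exact: nu_gt0.
Qed.

Lemma norm_dilation_le t x m : 0 < t <= 1 -> (forall i, m <= nu i) ->
  `|dilation nu t x| <= t `^ m * `|x|.
Proof.
move=> t01 mle; apply/rV_norm_le; first by rewrite mulr_ge0// powR_ge0.
move=> i; rewrite dilationE normrM ger0_norm ?powR_ge0//.
by rewrite ler_pM// ?powR_ge0 ?ger_powR// rV_coord_norm.
Qed.

End dilations.

(** * Triangular form of the group law *)

Lemma is_derive_coord_line (R : realType) (U : normedModType R) (n : nat)
    (f : U -> 'rV[R]_n) (z v : U) (s : R) (i : 'I_n) :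
  derivable f (z + s *: v) v ->
  is_derive s 1 (fun s => f (z + s *: v) ord0 i)
    ('D_v f (z + s *: v) ord0 i).
Proof.
move=> df.
have cv : h^-1 *: ((fun s => f (z + s *: v) ord0 i) (h *: 1 + s)
    - (fun s => f (z + s *: v) ord0 i) s) @[h --> 0^'] -->
    'D_v f (z + s *: v) ord0 i.
  have -> : (fun h : R => h^-1 *: ((fun s => f (z + s *: v) ord0 i) (h *: 1 + s)
    - (fun s => f (z + s *: v) ord0 i) s)) = (fun M : 'rV[R]_n => M ord0 i) \o
    (fun h : R => h^-1 *: (f (h *: v + (z + s *: v)) - f (z + s *: v))).
    apply/funext => h /=; rewrite !mxE /=.
    congr (_ *: (f _ ord0 i - _)).
    by rewrite scalerDl addrCA [h *: 1]mulr1.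
  have df' : h^-1 *: (f (h *: v + (z + s *: v)) - f (z + s *: v)) @[h --> 0^']
    --> 'D_v f (z + s *: v) := df.
  exact: (cvg_comp _ _ df' (@coord_continuous _ _ _ _ _ _)).
apply: DeriveDef; first by apply/cvg_ex; eexists; exact: cv.
exact/cvg_lim.
Qed.

Section group_law.
Context {R : realType} {n : nat} (G : homogeneousGroup R n).
Implicit Types (x y : 'rV[R]_n) (z v : 'rV[R]_n * 'rV[R]_n).

Local Notation nu := (hweight G).
Let f z := hmul G z.1 z.2.
Let dil2 (t : R) z := (dilation nu t z.1, dilation nu t z.2).

Lemma hmul_coord_mvt z v (T : R) i : 0 <= T ->
  exists2 c, 0 <= c <= T &
    f (z + T *: v) ord0 i - f z ord0 i = 'D_v f (z + c *: v) ord0 i * T.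
Proof.
move=> T0.
have [_ /(_ v)[df _]] := hmul_smooth G 1%N.
have [] := @MVT_segment R (fun s => f (z + s *: v) ord0 i)
  (fun s => 'D_v f (z + s *: v) ord0 i) 0 T T0.
- by move=> s _; apply: is_derive_coord_line; exact: df.
- apply: derivable_within_continuous => s _.
  have /(_ i) := @is_derive_coord_line R _ n f z v s ^~ (df _).
  by move=> [].
move=> c; rewrite in_itv/= => cT.
by rewrite scale0r addr0 subr0 => e; exists c.
Qed.

(** In a direction [v] that dilations scale by [t `^ nu j], the increment of a
    coordinate of weight at most [nu j] does not depend on the base point. *)
Lemma hmul_coord_shift_aux z v i j : nu i <= nu j ->
  (forall t, 0 < t -> dil2 t v = t `^ nu j *: v) ->
  f (z + v) ord0 i - f z ord0 i = f v ord0 i - f 0 ord0 i.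
Proof.
move=> ij hv.
have [_ /(_ v)[_ cD]] := hmul_smooth G 1%N.
have [m m0 mle] := weight_lower_bound (hweight_gt0 G).
pose g w := 'D_v f w ord0 i.
have cg : {for 0, continuous g}.
  apply: (@continuous_comp _ _ _ ('D_v f) (fun M : 'rV[R]_n => M ord0 i)).
    exact: cD.
  exact: coord_continuous.
have dil2D t a b : dil2 t (a + b) = dil2 t a + dil2 t b.
  by rewrite /dil2 /= !dilationD.
have fdil t w : 0 < t -> f (dil2 t w) ord0 i = t `^ nu i * f w ord0 i.
  by move=> t0; rewrite /f /= -hdilM// dilationE.
have key w t : 0 < t -> exists2 c, 0 <= c <= t `^ nu j &
    t `^ nu i * (f (w + v) ord0 i - f w ord0 i) =
    g (dil2 t w + c *: v) * t `^ nu j.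
  move=> t0.
  have [c cT e] := hmul_coord_mvt (dil2 t w) v i (powR_ge0 t (nu j)).
  by exists c => //; rewrite mulrBr -!fdil// dil2D hv.
apply/eqP; rewrite -subr_eq0; apply/eqP/normr0_eq0/eqP.
rewrite eq_le normr_ge0 andbT; apply/ler_addgt0Pr => e e0; rewrite add0r.
have e20 : 0 < e / 2 by rewrite divr_gt0.
have /cvgrPdist_lt /(_ _ e20) := cg.
move=> /nbhs_ballP[d /= d0 dg].
(* The dilation of ratio [t], where [t `^ m = u], multiplies norms by at most
   [u], and [u] is chosen so that all points where the derivative is evaluated
   are within [d] of the identity. *)
pose K := `|z| + `|v| + 1.
have K0 : 0 < K by rewrite ltr_pwDr// addr_ge0.
pose u := Num.min 1 (d / K / 2).
have u0 : 0 < u by rewrite /u lt_min ltr01/= !divr_gt0.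
have u1 : u <= 1 by rewrite /u ge_min lexx.
have uK : u * K < d.
  rewrite (@le_lt_trans _ _ (d / K / 2 * K))//.
    by rewrite ler_wpM2r ?(ltW K0)// /u ge_min lexx orbT.
  by rewrite mulrAC divfK ?gt_eqF// ltr_pdivrMr// ltr_pMr// ltr1n.
pose t := u `^ m^-1.
have t0 : 0 < t by rewrite powR_gt0.
have t1 : t <= 1.
  by rewrite -[leRHS](powRr0 u) /t ger_powR ?u0 ?u1 ?invr_ge0 ?(ltW m0).
have tm : t `^ m = u.
  by rewrite /t -powRrM mulVf ?gt_eqF// powRr1// ltW.
have bound w c : `|w| <= `|z| -> 0 <= c <= t `^ nu j ->
    `|g 0 - g (dil2 t w + c *: v)| < e / 2.
  move=> wz /andP[c0 ct].
  apply: dg; rewrite -ball_normE /ball_/= sub0r normrN.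
  apply: le_lt_trans uK; apply: le_trans (ler_normD _ _) _.
  rewrite /K -addrA mulrDr lerD//; last first.
    rewrite normrZ ger0_norm// (@le_trans _ _ (u * `|v|))// ?ler_wpM2r//.
      by rewrite -tm; apply: le_trans ct _; rewrite ger_powR// t0.
    by rewrite ler_wpM2l ?(ltW u0)// lerDl.
  rewrite prod_normE ge_max; apply/andP; split=> /=;
   rewrite (le_trans (@norm_dilation_le _ _ nu t _ m _ mle)) ?t0// tm;
   rewrite ler_wpM2l ?(ltW u0)//;
   apply: le_trans wz; rewrite [leRHS]prod_normE le_max lexx ?orbT//.
have [c ct e1] := key z t t0.
have [c' c't e2] := key 0 t t0.
rewrite add0r in e2.
have b1 := bound z c (lexx _) ct.
have b2 : `|g 0 - g (dil2 t 0 + c' *: v)| < e / 2.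
  by apply: bound => //; rewrite normr0.
set D := (X in `|X| <= _).
(* After rescaling, the difference of the two increments is a difference of two
   values of the derivative near the identity. *)
have De : D = t `^ (nu j - nu i) * (g (dil2 t z + c *: v) - g (dil2 t 0 + c' *: v)).
  have ti0 : t `^ nu i != 0 by rewrite gt_eqF// powR_gt0.
  apply: (mulfI ti0); rewrite /D mulrBr e1 e2 -mulrBl mulrA -powRD.
    by rewrite subrKC mulrC.
  by rewrite (gt_eqF t0) implybT.
rewrite De normrM ger0_norm ?powR_ge0//.
rewrite -[e]mul1r ler_pM ?powR_ge0//.
  by rewrite -[leRHS](powRr0 t) ger_powR ?t0// subr_ge0.
apply: le_trans (ler_distD (g 0) _ _) _.
rewrite (splitr e); apply: lerD; last exact: ltW b2.
by rewrite distrC; exact: ltW b1.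
Qed.

Let ej j : 'rV[R]_n := delta_mx ord0 j.

Lemma dilation_delta t s j : dilation nu t (s *: ej j) = t `^ nu j *: (s *: ej j).
Proof.
apply/rowP => k; rewrite !mxE eqxx/=.
by have [->|_] := eqVneq k j; rewrite ?mulr1// !mulr0.
Qed.

Lemma hmul_coord_shiftl x y s i j : nu i <= nu j ->
  hmul G (x + s *: ej j) y ord0 i - hmul G x y ord0 i = (s *: ej j) ord0 i.
Proof.
move=> ij.
have := @hmul_coord_shift_aux (x, y) (s *: ej j, 0) i j ij.
rewrite /f/= addr0 !hmulg0 [(0 : 'rV[R]_n) ord0 i]mxE subr0; apply => t t0.
by rewrite /dil2/= dilation0 dilation_delta; congr (_, _); rewrite /= scaler0.
Qed.

Lemma hmul_coord_shiftr x y s i j : nu i <= nu j ->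
  hmul G x (y + s *: ej j) ord0 i - hmul G x y ord0 i = (s *: ej j) ord0 i.
Proof.
move=> ij.
have := @hmul_coord_shift_aux (x, y) (0, s *: ej j) i j ij.
rewrite /f/= addr0 !hmul0g [(0 : 'rV[R]_n) ord0 i]mxE subr0; apply => t t0.
by rewrite /dil2/= dilation0 dilation_delta; congr (_, _); rewrite /= scaler0.
Qed.

Lemma hmul_coordl x x' y i : (forall j, nu j < nu i -> x ord0 j = x' ord0 j) ->
  hmul G x y ord0 i - x ord0 i = hmul G x' y ord0 i - x' ord0 i.
Proof.
move=> xx'.
suff H (s : seq 'I_n) (a : 'rV[R]_n) : (forall j, nu j < nu i -> a ord0 j = 0) ->
    hmul G (x' + \sum_(j <- s) a ord0 j *: ej j) y ord0 i - hmul G x' y ord0 i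
    = (\sum_(j <- s) a ord0 j *: ej j) ord0 i.
  have := H (index_enum _) (x - x').
  have -> : \sum_(j <- index_enum 'I_n) (x - x') ord0 j *: ej j = x - x'.
    by rewrite -row_sum_delta.
  rewrite (addrC x') subrK => e.
  have : forall j, nu j < nu i -> (x - x') ord0 j = 0.
    by move=> j /xx' e1; rewrite !mxE e1 subrr.
  by move=> /e; rewrite !mxE; lra.
move=> a0; elim: s => [|j s IH]; first by rewrite !big_nil addr0 subrr mxE.
rewrite !big_cons [in RHS]mxE -IH (addrC (_ *: _)) addrA.
have [ji|ij] := ltP (nu j) (nu i).
  by rewrite a0// scale0r addr0 mxE add0r.
rewrite -(hmul_coord_shiftl (x' + \sum_(k <- s) a ord0 k *: ej k) y (a ord0 j) ij).
by rewrite addrA subrK.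
Qed.

Lemma hmul_coordr x y y' i : (forall j, nu j < nu i -> y ord0 j = y' ord0 j) ->
  hmul G x y ord0 i - y ord0 i = hmul G x y' ord0 i - y' ord0 i.
Proof.
move=> yy'.
suff H (s : seq 'I_n) (a : 'rV[R]_n) : (forall j, nu j < nu i -> a ord0 j = 0) ->
    hmul G x (y' + \sum_(j <- s) a ord0 j *: ej j) ord0 i - hmul G x y' ord0 i
    = (\sum_(j <- s) a ord0 j *: ej j) ord0 i.
  have := H (index_enum _) (y - y').
  have -> : \sum_(j <- index_enum 'I_n) (y - y') ord0 j *: ej j = y - y'.
    by rewrite -row_sum_delta.
  rewrite (addrC y') subrK => e.
  have : forall j, nu j < nu i -> (y - y') ord0 j = 0.
    by move=> j /yy' e1; rewrite !mxE e1 subrr.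
  by move=> /e; rewrite !mxE; lra.
move=> a0; elim: s => [|j s IH]; first by rewrite !big_nil addr0 subrr mxE.
rewrite !big_cons [in RHS]mxE -IH (addrC (_ *: _)) addrA.
have [ji|ij] := ltP (nu j) (nu i).
  by rewrite a0// scale0r addr0 mxE add0r.
rewrite -(hmul_coord_shiftr x (y' + \sum_(k <- s) a ord0 k *: ej k) (a ord0 j) ij).
by rewrite addrA subrK.
Qed.

(** The group law is triangular: the [i]-th coordinate of [x y] is
    [x_i + y_i] plus a function of the coordinates of smaller weight. *)
Lemma hmul_triangular x x' y y' i :
  (forall j, nu j < nu i -> x ord0 j = x' ord0 j) ->
  (forall j, nu j < nu i -> y ord0 j = y' ord0 j) ->
  hmul G x y ord0 i - x ord0 i - y ord0 i =
  hmul G x' y' ord0 i - x' ord0 i - y' ord0 i.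
Proof.
move=> /(@hmul_coordl _ _ y) e1 /(@hmul_coordr x') e2; move: e1 e2; lra.
Qed.

End group_law.
(** * Tilings by translates of dilated unit cells *)

(** The image of the half-open unit cube under the dilation of ratio [e]. *)
Definition cell (R : realType) (n : nat) (nu : 'I_n -> R) (e : R) :
    set 'rV[R]_n :=
  [set y | forall i, 0 <= y ord0 i < e `^ nu i].

(** The point of the lattice of mesh [e `^ nu i] in the direction [i] with
    integer coordinates [m]. *)
Definition lattice_point (R : realType) (n : nat) (nu : 'I_n -> R) (e : R)
    (m : 'I_n -> int) : 'rV[R]_n :=
  \row_i ((m i)%:~R * e `^ nu i).

(** Ranks provide a bounded integer measure for inductions on weights. *)
Lemma weight_rank (R : realType) (n : nat) (nu : 'I_n -> R) :
  exists2 r : 'I_n -> nat, forall i, (r i <= n)%N &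
    forall i j, nu j < nu i -> (r j < r i)%N.
Proof.
exists (fun i => #|[set j | nu j < nu i]%SET|) => [i|i j ji].
  by rewrite -[leqRHS](card_ord n) max_card.
apply: proper_card; apply/properP; split.
  by apply/fintype.subsetP => k; rewrite !inE => kj; exact: lt_trans ji.
by exists j; rewrite !inE// ltxx.
Qed.

Lemma weight_ind (R : realType) (n : nat) (nu : 'I_n -> R) (P : 'I_n -> Prop) :
  (forall i, (forall j, nu j < nu i -> P j) -> P i) -> forall i, P i.
Proof.
move=> IH; have [r rn rlt] := weight_rank nu.
move=> i; have [m] := ubnP (r i); elim: m i => // m IHm i rim.
apply: IH => j ji; apply: IHm; exact: leq_trans (rlt _ _ ji) _.
Qed.

Section tiling.
Context {R : realType} {n : nat} (G : homogeneousGroup R n).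
Implicit Types (x y z : 'rV[R]_n).

Local Notation nu := (hweight G).
Local Notation cell := (cell nu).
Local Notation lattice_point := (lattice_point nu).

(** Left translates of a cell by distinct lattice points are disjoint. *)
Lemma tile_uniq e m m' y y' : 0 < e -> cell e y -> cell e y' ->
  hmul G (lattice_point e m) y = hmul G (lattice_point e m') y' -> m =1 m'.
Proof.
move=> e0 cy cy' E.
suff H : forall i, m i = m' i /\ y ord0 i = y' ord0 i by move=> i; case: (H i).
apply: (weight_ind (nu := nu)) => i IH.
have s0 : 0 < e `^ nu i by rewrite powR_gt0.
have lm j : nu j < nu i -> lattice_point e m ord0 j = lattice_point e m' ord0 j.
  by move=> /IH[mm _]; rewrite !mxE mm.
have ly j : nu j < nu i -> y ord0 j = y' ord0 j by move=> /IH[].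
have := hmul_triangular lm ly; rewrite E !mxE => H.
have {}H : (m i)%:~R * e `^ nu i + y ord0 i = (m' i)%:~R * e `^ nu i + y' ord0 i.
  by move: H; lra.
suff mm : m i = m' i.
  by split=> //; move: H; rewrite mm => /addrI.
have fl (k : int) (v : 'rV[R]_n) : cell e v ->
    Num.floor ((k%:~R * e `^ nu i + v ord0 i) / e `^ nu i) = k.
  move=> /(_ i)/andP[v0 v1]; apply/floor_def.
  rewrite mulrDl mulfK ?gt_eqF// intrD ler_wpDr//= ?ltrD2l.
    by rewrite ltr_pdivrMr// mul1r.
  by rewrite divr_ge0// ltW.
by rewrite -(fl (m i) _ cy) H fl.
Qed.

(** Left translates of a cell by the lattice points cover the group. *)
Lemma tile_exists e z : 0 < e ->
  exists m y, cell e y /\ hmul G (lattice_point e m) y = z.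
Proof.
move=> e0; have [r rn rlt] := weight_rank nu.
suff H k : exists m y, cell e y /\ forall i, (r i < k)%N ->
    hmul G (lattice_point e m) y ord0 i = z ord0 i.
  have [m [y [cy E]]] := H n.+1; exists m, y; split => //.
  apply/rowP => i; by apply: E; rewrite ltnS.
elim: k => [|k [m [y [cy E]]]].
  exists (fun=> 0), 0; split => // i; rewrite mxE lexx/= powR_gt0//.
(* Coordinates whose weight has rank [k] are corrected; they do not affect the
   coordinates of smaller or equal weight. *)
pose w i := z ord0 i - (hmul G (lattice_point e m) y ord0 i
             - lattice_point e m ord0 i - y ord0 i).
pose m' i := if r i == k then Num.floor (w i / e `^ nu i) else m i.
pose y' : 'rV[R]_n := \row_i if r i == k then w i - (m' i)%:~R * e `^ nu i else y ord0 i.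
have small i j : (r i <= k)%N -> nu j < nu i -> r j == k = false.
  by move=> ik /rlt ji; apply/negbTE; rewrite neq_ltn (leq_trans ji).
have T i : (r i <= k)%N -> hmul G (lattice_point e m') y' ord0 i
    - lattice_point e m' ord0 i - y' ord0 i
    = hmul G (lattice_point e m) y ord0 i - lattice_point e m ord0 i - y ord0 i.
  by move=> ik; apply: hmul_triangular => j ji; rewrite !mxE ?/m' (small _ _ ik ji).
exists m', y'; split=> [i|i].
  rewrite mxE; case: ifP => [ik|_]; last exact: cy.
  have s0 : 0 < e `^ nu i by rewrite powR_gt0.
  have /andP[f0 f1] := floor_itv (w i / e `^ nu i).
  rewrite /m' ik subr_ge0 -ler_pdivlMr// f0 ltrBlDl.
  by move: f1; rewrite intrD ltr_pdivrMr// mulrDl mul1r.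
rewrite ltnS => ik; have := T i ik; rewrite !mxE /m'.
case: ifP => [rik|rik]; rewrite ?rik/=.
  rewrite /w mxE; lra.
have {}ik : (r i < k)%N by rewrite ltn_neqAle rik.
move: (E i ik); lra.
Qed.

Lemma prod_weight (t : R) : 0 < t ->
  \prod_(i < n) t `^ nu i = t `^ homogeneous_dim G.
Proof.
move=> t0; rewrite /homogeneous_dim.
elim/big_rec2 : _ => [|i a b _ ->]; first by rewrite powRr0.
by rewrite powRD// (gt_eqF t0) implybT.
Qed.

End tiling.

(** * Compactness *)

Lemma pair_continuous (T U V : topologicalType) (f : T -> U) (g : T -> V) :
  continuous f -> continuous g -> continuous (fun x => (f x, g x)).
Proof. by move=> cf cg x; apply: cvg_pair; [exact: cf|exact: cg]. Qed.

Lemma compose_continuous (T U V : topologicalType) (f : T -> U) (g : U -> V) :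
  continuous f -> continuous g -> continuous (fun x => g (f x)).
Proof. by move=> cf cg x; apply: continuous_comp; [exact: cf|exact: cg]. Qed.

Lemma compact_bounded_above (R : realType) (T : topologicalType)
    (f : T -> R) (A : set T) :
  compact A -> continuous f -> exists2 M, 0 < M & forall x, A x -> f x <= M.
Proof.
move=> cA cf; have [->|/set0P A0] := eqVneq A set0; first by exists 1 => // x [].
have [c _ fc] := compact_EVT_max A0 cA (continuous_subspaceT cf).
exists (`|f c| + 1); first by rewrite ltr_wpDl.
move=> x Ax; apply: (le_trans (fc x _)); first by rewrite inE.
by rewrite ler_wpDr// ler_norm.
Qed.

Section compactness.
Context {R : realType} {n : nat} (G : homogeneousGroup R n).
Implicit Types (x y z : 'rV[R]_n).
Local Notation nu := (hweight G).

Lemma hmul_continuous : continuous (fun z : 'rV[R]_n * 'rV[R]_n => hmul G z.1 z.2).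
Proof. exact: (hmul_smooth G 0%N). Qed.

Lemma hinv_continuous : continuous (hinv G).
Proof. exact: (hinv_smooth G 0%N). Qed.

Lemma hmull_continuous x : continuous (hmul G x).
Proof.
have cp : continuous (fun y : 'rV[R]_n => (x, y)).
  by apply: pair_continuous => y; [exact: cst_continuous|exact: cvg_id].
exact: (compose_continuous cp hmul_continuous).
Qed.

Lemma hmulVl_continuous :
  continuous (fun z : 'rV[R]_n * 'rV[R]_n => hmul G z.1 (hinv G z.2)).
Proof.
have cp : continuous (fun z : 'rV[R]_n * 'rV[R]_n => (z.1, hinv G z.2)).
  apply: pair_continuous => z; first exact: cvg_fst.
  apply: (compose_continuous (f := snd) _ hinv_continuous) => {}z.
  exact: cvg_snd.
exact: (compose_continuous cp hmul_continuous).
Qed.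

Lemma unit_box_compact : compact [set x : 'rV[R]_n | `|x| <= 1].
Proof.
apply: bounded_closed_compact.
  exists 1; split; first exact: num_real.
  by move=> M M1 x /= x1; rewrite (le_trans x1)// ltW.
have := @preimage_closed _ _ (Num.norm : 'rV[R]_n -> R) [set x | x <= 1]
  (fun x _ => @norm_continuous R _ x) (@closed_le R 1).
by [].
Qed.

Lemma unit_sphere_compact : compact [set x : 'rV[R]_n | `|x| = 1].
Proof.
apply: (subclosed_compact _ unit_box_compact) => [|x /= ->//].
have := @preimage_closed _ _ (Num.norm : 'rV[R]_n -> R) [set 1]
  (fun x _ => @norm_continuous R _ x) (@closed_eq R 1).
by [].
Qed.

Lemma cell_unit_box e y : 0 < e <= 1 -> cell nu e y -> `|y| <= 1.
Proof.
move=> e01 cy; apply/rV_norm_le => // i; have /andP[y0 y1] := cy i.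
rewrite ger0_norm// (le_trans (ltW y1))//.
by rewrite -[leRHS](powRr0 e) ger_powR// ltW// hweight_gt0.
Qed.

(** Every nonzero vector has a dilate on the unit sphere of the sup norm. *)
Lemma dilation_normalize x : x <> 0 -> exists2 t, 0 < t & `|dilation nu t x| = 1.
Proof.
move=> x0.
have [i0 xi0] : exists i, x ord0 i != 0.
  apply: contrapT => H; apply: x0; apply/rowP => i; rewrite mxE.
  by apply: contrapT => /eqP xi0; apply: H; exists i.
pose F i := `|x ord0 i| `^ (nu i)^-1.
have nu0 i : nu i != 0 by rewrite gt_eqF// hweight_gt0.
have FE i : F i `^ nu i = `|x ord0 i| by rewrite -powRrM mulVf// powRr1.
have [i Fi0 Fi] : exists2 i, 0 < F i & forall j, F j <= F i.
  case: (@arg_maxP _ _ _ i0 predT F isT) => i _ Fi; exists i => [|j]; last exact: Fi.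
  by apply: lt_le_trans (Fi i0 isT); rewrite powR_gt0// normr_gt0.
have ti0 : 0 < (F i)^-1 by rewrite invr_gt0.
exists (F i)^-1 => //; apply/eqP; rewrite eq_le; apply/andP; split.
  apply/rV_norm_le => // j; rewrite dilationE normrM ger0_norm ?powR_ge0//.
  rewrite -FE -powRM ?powR_ge0 ?invr_ge0 ?powR_ge0//.
  have one_powR : 1 `^ nu j = 1 :> R by rewrite powR1.
  rewrite -[leRHS]one_powR ge0_ler_powR ?nnegrE ?mulr_ge0 ?invr_ge0 ?powR_ge0//.
    by rewrite ltW// hweight_gt0.
  by rewrite mulrC ler_pdivrMr// mul1r.
apply: le_trans (rV_coord_norm _ i).
rewrite dilationE normrM ger0_norm ?powR_ge0// -FE -powRM ?powR_ge0 ?invr_ge0 ?powR_ge0//.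
by rewrite mulVf ?gt_eqF// powR1.
Qed.

Context (N : 'rV[R]_n -> R) (N_quasinorm : is_quasinorm G N).

Lemma quasinorm_gt0 x : x <> 0 -> 0 < N x.
Proof.
move=> x0; rewrite lt_neqAle eq_sym (quasinorm_ge0 N_quasinorm) andbT.
by apply/eqP => /(quasinorm_eq0 N_quasinorm).
Qed.

(** Comparison of the quasi-norm with the coordinates. *)
Lemma quasiball_coord : exists2 a, 0 < a &
  forall x i, `|x ord0 i| <= (N x / a) `^ nu i.
Proof.
have [a a0 ale] : exists2 a, 0 < a & forall x, `|x| = 1 -> a <= N x.
  have [A0|/set0P A0] := eqVneq [set x : 'rV[R]_n | `|x| = 1] set0.
    by exists 1 => // x x1; have : set0 x by rewrite -A0.
  have [c /set_mem /= c1 fc] := compact_EVT_min A0 unit_sphere_compact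
    (continuous_subspaceT (quasinorm_continuous N_quasinorm)).
  exists (N c) => [|x x1]; last by apply: fc; rewrite inE.
  apply: quasinorm_gt0 => c0; move: c1; rewrite c0 normr0 => /eqP.
  by rewrite eq_sym oner_eq0.
exists a => // x i.
have [->|/eqP/dilation_normalize [t t0 xt]] := eqVneq x 0.
  by rewrite mxE normr0 powR_ge0.
have := ale _ xt; rewrite (quasinormZ N_quasinorm)// => atN.
have : `|dilation nu t x ord0 i| <= 1 by rewrite -xt rV_coord_norm.
rewrite dilationE normrM ger0_norm ?powR_ge0// mulrC -ler_pdivlMr ?powR_gt0// mul1r.
have -> : (t `^ nu i)^-1 = t^-1 `^ nu i.
  by rewrite -powRN -[in RHS](powR_inv1 (ltW t0)) -powRrM mulN1r.
move=> /le_trans; apply; rewrite ge0_ler_powR ?nnegrE ?(ltW (hweight_gt0 _ _))//.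
- by rewrite invr_ge0 ltW.
- by rewrite divr_ge0 ?(quasinorm_ge0 N_quasinorm)// ltW.
- by rewrite ler_pdivlMr// mulrC ler_pdivrMr// mulrC.
Qed.

Lemma quasiball_bounded r : exists2 M, 0 < M & forall x, N x <= r -> `|x| <= M.
Proof.
have [a a0 H] := quasiball_coord.
exists (1 + \sum_i (`|r| / a) `^ nu i).
  by rewrite ltr_pwDl// sumr_ge0// => i _; exact: powR_ge0.
move=> x xr; apply/rV_norm_le.
  by rewrite addr_ge0// sumr_ge0// => i _; exact: powR_ge0.
move=> i; apply: (le_trans (H x i)); apply: ler_wpDl => //.
rewrite (bigD1 i)//= ler_wpDr//.
  by rewrite sumr_ge0// => j _; exact: powR_ge0.
have Nx0 := quasinorm_ge0 N_quasinorm x.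
rewrite ge0_ler_powR ?nnegrE ?(ltW (hweight_gt0 _ _))//.
- by rewrite divr_ge0// ltW.
- by rewrite divr_ge0// ltW.
- by rewrite ler_wpM2r ?invr_ge0 ?(ltW a0)// (le_trans xr)// ler_norm.
Qed.

Lemma closed_quasiball_compact r : compact [set x | N x <= r].
Proof.
apply: bounded_closed_compact.
  have [M M0 H] := quasiball_bounded r.
  exists M; split; first exact: num_real.
  by move=> M' MM' x /= /H xM; rewrite (le_trans xM)// ltW.
apply: (preimage_closed (f := N) (D := [set x | x <= r])); last exact: closed_le.
by move=> x _; exact: (quasinorm_continuous N_quasinorm).
Qed.

(** At most [c e^-Q] translates of the cell of size [e] cover the unit ball. *)
Lemma quasiball_cover : exists2 c, 0 < c & forall e, 0 < e <= 1 ->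
  exists K (x : 'I_K -> 'rV[R]_n), K%:R <= c * e `^ (- homogeneous_dim G) /\
    forall z, N z <= 1 -> exists k y, cell nu e y /\ z = hmul G (x k) y.
Proof.
have cK : compact ([set x : 'rV[R]_n | N x <= 1] `*` [set x : 'rV[R]_n | `|x| <= 1]).
  by apply: compact_setX; [exact: closed_quasiball_compact|exact: unit_box_compact].
have cf : continuous (fun z : 'rV[R]_n * 'rV[R]_n => `|hmul G z.1 (hinv G z.2)|).
  by apply: compose_continuous; [exact: hmulVl_continuous|exact: norm_continuous].
have [M0 M00 HM0] := compact_bounded_above cK cf.
(* The lattice coordinates of the relevant tiles are at most [S i] in absolute
   value; adding 1 to the bound makes [S i] at least 1, which absorbs the
   rounding in the count. *)
pose M := M0 + 1.
have M1 : 1 <= M by rewrite lerDr ltW.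
exists ((3 * M) ^+ n); first by rewrite exprn_gt0// mulr_gt0// (lt_le_trans _ M1).
move=> e e01; have /andP[e0 e1] := e01.
pose S i := M * e `^ (- nu i).
have S1 i : 1 <= S i.
  rewrite -[leLHS]mulr1 ler_pM// -[leLHS](powRr0 e) ger_powR// oppr_le0 ltW//.
  exact: hweight_gt0.
have S0 i : 0 <= S i by rewrite (le_trans _ (S1 i)).
pose L i := Num.truncn (S i).
pose I := {dffun forall i : 'I_n, 'I_((L i).*2.+1)}.
pose pt (g : I) := lattice_point nu e (fun i => (g i : nat)%:Z - (L i)%:Z).
exists #|I|, (fun k => pt (enum_val k)); split.
  rewrite (_ : #|I| = \prod_i (L i).*2.+1)%N; last first.
    rewrite card_dep_ffun foldrE big_image/=.
    by apply: eq_bigr => i _; rewrite card_ord.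
  rewrite natr_prod.
  have -> : e `^ (- homogeneous_dim G) = \prod_(i < n) e `^ (- nu i).
    have ei0 : 0 < e `^ (-1) by rewrite powR_gt0.
    rewrite -mulN1r powRrM -prod_weight//.
    by apply: eq_bigr => i _; rewrite -powRrM mulN1r.
  have -> : (3 * M) ^+ n = \prod_(i < n) (3 * M) by rewrite prodr_const card_ord.
  rewrite -big_split/=; apply: ler_prod => i _; rewrite ler0n/=.
  rewrite -mulrA -/(S i) -addn1 natrD -muln2 natrM.
  have : (L i)%:R <= S i by rewrite truncn_le.
  by move: (S1 i); lra.
move=> z z1.
have [m [y [cy E]]] := tile_exists G z e0.
have zE : lattice_point nu e m = hmul G z (hinv G y).
  by rewrite -E -hmulA hmulgV hmulg0.
have xM i : `|m i|%:~R <= S i.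
  have : `|lattice_point nu e m| <= M0.
    rewrite zE; apply: (HM0 (z, y)); split=> //=; exact: cell_unit_box cy.
  move=> /(le_trans (rV_coord_norm _ i)); rewrite mxE normrM.
  rewrite (ger0_norm (powR_ge0 _ _)) -ler_pdivlMr ?powR_gt0// -powRN.
  rewrite -intr_norm => /le_trans; apply.
  by rewrite ler_wpM2r ?powR_ge0// lerDl.
have mL i : (`|m i|%N <= L i)%N.
  by rewrite truncn_ge_nat// natr_absz.
have gi i : (absz (m i + (L i)%:Z)%R < (L i).*2.+1)%N.
  by move: (mL i); lia.
pose g : I := [ffun i => Ordinal (gi i)].
exists (enum_rank g), y; split => //.
rewrite enum_rankK -E; congr (hmul G _ y); apply/rowP => i; rewrite !mxE ffunE/=.
congr (_%:~R * _); move: (mL i); lia.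
Qed.

(** At least [c e^-Q] disjoint translates of the cell of size [e] fit into a
    fixed ball. *)
Lemma quasiball_packing : exists c C, [/\ 0 < c, 0 < C & forall e, 0 < e <= 1 ->
  exists K (x : 'I_K -> 'rV[R]_n), [/\ c * e `^ (- homogeneous_dim G) <= K%:R,
    forall k y, cell nu e y -> N (hmul G (x k) y) < C &
    forall k k' y y', cell nu e y -> cell nu e y' ->
      hmul G (x k) y = hmul G (x k') y' -> k = k']].
Proof.
have cK : compact ([set x : 'rV[R]_n | `|x| <= 1] `*` [set x : 'rV[R]_n | `|x| <= 1]).
  by apply: compact_setX; exact: unit_box_compact.
have cf : continuous (fun z : 'rV[R]_n * 'rV[R]_n => N (hmul G z.1 z.2)).
  apply: compose_continuous; first exact: hmul_continuous.
  exact: (quasinorm_continuous N_quasinorm).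
have [M M0 HM] := compact_bounded_above cK cf.
exists (2^-1 ^+ n), (M + 1); split; first by rewrite exprn_gt0.
  by rewrite addr_gt0.
move=> e e01; have /andP[e0 e1] := e01.
(* Lattice points of the unit cube: about [S i] in the direction [i]. *)
pose S i := e `^ (- nu i).
have S1 i : 1 <= S i.
  rewrite -[leLHS](powRr0 e) ger_powR// oppr_le0 ltW//.
  exact: hweight_gt0.
have S0 i : 0 <= S i by rewrite (le_trans _ (S1 i)).
pose L i := Num.truncn (S i).
pose I := {dffun forall i : 'I_n, 'I_(L i)}.
pose pt (g : I) := lattice_point nu e (fun i => (g i : nat)%:Z).
exists #|I|, (fun k => pt (enum_val k)); split.
- rewrite (_ : #|I| = \prod_i (L i))%N; last first.
    rewrite card_dep_ffun foldrE big_image/=.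
    by apply: eq_bigr => i _; rewrite card_ord.
  rewrite natr_prod.
  have -> : e `^ (- homogeneous_dim G) = \prod_(i < n) e `^ (- nu i).
    have ei0 : 0 < e `^ (-1) by rewrite powR_gt0.
    rewrite -mulN1r powRrM -prod_weight//.
    by apply: eq_bigr => i _; rewrite -powRrM mulN1r.
  have -> : 2^-1 ^+ n = \prod_(i < n) 2^-1 :> R by rewrite prodr_const card_ord.
  rewrite -big_split/=; apply: ler_prod => i _; rewrite mulr_ge0 ?powR_ge0//=.
  have /andP[_] := truncn_itv (S0 i); rewrite -/(L i) -/(S i) -natr1.
  have : 1 <= (L i)%:R :> R by rewrite ler1n truncn_gt0.
  by lra.
- move=> k y cy; rewrite (@le_lt_trans _ _ M)// ?ltrDl//.
  apply: (HM (_, y)); split=> /=; last exact: cell_unit_box cy.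
  apply/rV_norm_le => // i; rewrite !mxE ger0_norm ?mulr_ge0 ?powR_ge0//.
  rewrite -ler_pdivlMr ?powR_gt0// mul1r -powRN -pmulrn.
  rewrite (@le_trans _ _ (L i)%:R) ?truncn_le//.
  by rewrite ler_nat ltnW.
- move=> k k' y y' cy cy' /(tile_uniq e0 cy cy') E.
  apply: enum_val_inj; apply/ffunP => i; apply/val_inj.
  by have := E i; case.
Qed.

End compactness.
(** * Growth of the Haar measure of balls *)

Section borel.
Context {R : realType} {n : nat}.

Lemma open_borel (A : set 'rV[R]_n) : open A -> measurable (A : set (borelRV R n)).
Proof. by move=> oA; exact: sub_sigma_algebra. Qed.

Lemma continuous_borel_real (f : 'rV[R]_n -> R) : continuous f ->
  measurable_fun setT (f : borelRV R n -> R).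
Proof.
move=> /continuousP cf; apply: (measurability _ (RGenOpens.measurableE R)).
move=> _ [_ [a [b ->]] <-]; rewrite setTI; apply: open_borel.
by apply: cf; exact: interval_open.
Qed.

Lemma continuous_borel (f : 'rV[R]_n -> 'rV[R]_n) : continuous f ->
  measurable_fun setT (f : borelRV R n -> borelRV R n).
Proof.
move=> /continuousP cf; apply: (@measurability _ _ (borelRV R n) (borelRV R n) setT f
  (@open 'rV[R]_n)) => //.
by move=> _ [A oA <-]; rewrite setTI; apply: open_borel; exact: cf.
Qed.

Lemma cell_borel (nu : 'I_n -> R) e : measurable (cell nu e : set (borelRV R n)).
Proof.
rewrite (_ : cell nu e = \bigcap_(i in [set: 'I_n])
    ((fun y : 'rV[R]_n => y ord0 i) @^-1` `[0, e `^ nu i[%classic)); last first.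
  by apply/seteqP; split => y H i => [_|]; [|have := H i I]; rewrite /= in_itv/=.
apply: (@fin_bigcap_measurable _ (borelRV R n)) => // i _.
rewrite -[X in measurable X]setTI.
have := @continuous_borel_real (fun y : 'rV[R]_n => y ord0 i).
by apply => //; exact: coord_continuous.
Qed.

End borel.

Lemma sume_const_ord (R : realType) (K : nat) (m : \bar R) :
  (\sum_(k < K) m = K%:R%:E * m)%E.
Proof.
elim: K => [|K IH]; first by rewrite big_ord0 mul0e.
by rewrite big_ord_recr/= IH -natr1 EFinD ge0_muleDl ?lee_fin// mul1e.
Qed.

Section finite_covers.
Local Open Scope ereal_scope.
Context d (T : measurableType d) (R : realType) (mu : {measure set T -> \bar R}).
Variables (K : nat) (F : 'I_K -> set T) (A : set T) (m : \bar R).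
Hypotheses (mA : measurable A) (mF : forall k, measurable (F k)).

Lemma measure_le_cover : (forall k, mu (F k) = m) ->
  (forall x, A x -> exists k, F k x) -> mu A <= K%:R%:E * m.
Proof.
move=> Fm AF.
have mU : measurable (\big[setU/set0]_(k < K) F k).
  by apply: bigsetU_measurable => k _; exact: mF.
apply: (@le_trans _ _ (mu (\big[setU/set0]_(k < K) F k))).
  apply: le_measure; rewrite ?inE// => x /AF[k Fk].
  by rewrite (bigD1 k)//=; left.
apply: (@le_trans _ _ (\sum_(k < K) mu (F k))).
  suff [] : measurable (\big[setU/set0]_(k < K) F k) /\
      mu (\big[setU/set0]_(k < K) F k) <= \sum_(k < K) mu (F k) by [].
  elim/big_ind2 : _ => [|a A' b B' [ma aA] [mb bB]|k _]; rewrite ?measure0//.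
  split; first exact: measurableU.
  exact: le_trans (measureU2 _ ma mb) (leeD aA bB).
by rewrite (eq_bigr (fun=> m))// sume_const_ord.
Qed.

Lemma measure_ge_packing : (forall k, mu (F k) = m) ->
  (forall k x, F k x -> A x) -> (forall k k' x, F k x -> F k' x -> k = k') ->
  K%:R%:E * m <= mu A.
Proof.
move=> Fm FA Finj.
apply: (@le_trans _ _ (mu (\big[setU/set0]_(k < K) F k))); last first.
  apply: le_measure; rewrite ?inE//; first exact: bigsetU_measurable.
  by elim/big_ind : _ => // [B C BA CA x [/BA|/CA]|k _ x /FA].
rewrite measure_bigsetU_ord//.
  rewrite -sume_const_ord le_eqVlt; apply/orP; left; apply/eqP.
  by apply: eq_bigr => k _; exact/esym/Fm.
by move=> k k' _ _ [x [Fk Fk']]; exact: Finj Fk Fk'.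
Qed.

End finite_covers.

Section volume.
Context {R : realType} {n : nat} (G : homogeneousGroup R n).
Context (N : 'rV[R]_n -> R) (N_quasinorm : is_quasinorm G N).
Context (mu : {measure set (borelRV R n) -> \bar R}) (mu_haar : is_haar G mu).
Implicit Types (x y z : 'rV[R]_n).
Local Notation nu := (hweight G).
Local Notation Q := (homogeneous_dim G).
Local Notation ball r := (quasiball N r).

Lemma quasinorm_borel : measurable_fun setT (N : borelRV R n -> R).
Proof.
by apply: continuous_borel_real; exact: (quasinorm_continuous N_quasinorm).
Qed.

Lemma quasiball_borel r : measurable (ball r : set (borelRV R n)).
Proof.
rewrite (_ : ball r = setT `&` N @^-1` `]-oo, r[%classic).
  exact: quasinorm_borel.
by apply/seteqP; split => [x xr|x [_]]; [split=> //|]; rewrite /= in_itv.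
Qed.

Lemma translate_borel x (A : set (borelRV R n)) : measurable A ->
  measurable (hmul G x @` A : set (borelRV R n)).
Proof.
move=> mA; rewrite (_ : hmul G x @` A = hmul G (hinv G x) @^-1` A).
  rewrite -[X in measurable X]setTI.
  have cx : continuous (hmul G (hinv G x)) by exact: hmull_continuous.
  by have /(_ measurableT _ mA) := continuous_borel cx.
apply/seteqP; split => [_ [y Ay <-]|y Ay] /=; first by rewrite hmulA hmulVg hmul0g.
by exists (hmul G (hinv G x) y) => //; rewrite hmulA hmulgV hmul0g.
Qed.

Lemma dilation_cell r e y : 0 < r -> 0 < e ->
  cell nu (r * e) y <-> cell nu e (dilation nu r^-1 y).
Proof.
move=> r0 e0; split => cy i; have := cy i; rewrite mxE powRM ?(ltW r0) ?(ltW e0)//.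
all: rewrite -powR_inv1 ?(ltW r0)// -powRrM mulN1r powRN.
all: by rewrite ![_^-1 * _]mulrC ler_pdivlMr ?ltr_pdivrMr ?powR_gt0// mul0r mulrC.
Qed.

Lemma quasiball_cover_measure : exists2 c, 0 < c & forall r e, 0 < r -> 0 < e <= 1 ->
  (mu (ball r) <= (c * e `^ (- Q))%:E * mu (cell nu (r * e)))%E.
Proof.
have [c c0 H] := quasiball_cover N_quasinorm; exists c => // r e r0 e01.
have /andP[e0 e1] := e01.
have [K [x [Kc cov]]] := H e e01.
apply: (@le_trans _ _ (K%:R%:E * mu (cell nu (r * e)))%E); last first.
  by rewrite lee_wpmul2r// lee_fin.
apply: (@measure_le_cover _ (borelRV R n) _ mu _
  (fun k => hmul G (dilation nu r (x k)) @` cell nu (r * e))).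
- exact: quasiball_borel.
- by move=> k; apply: translate_borel; exact: cell_borel.
- by move=> k; apply: (haar_left_invariant mu_haar); exact: cell_borel.
- move=> z zr; have : N (dilation nu r^-1 z) <= 1.
    rewrite (quasinormZ N_quasinorm) ?invr_gt0// mulrC ler_pdivrMr// mul1r ltW//.
  move=> /cov [k [y [cy E]]]; exists k, (dilation nu r y).
    by apply/dilation_cell => //; rewrite dilationK.
  by rewrite -hdilM// -E dilationVK.
Qed.

Lemma quasiball_packing_measure : exists c C, [/\ 0 < c, 0 < C &
  forall r e, 0 < r -> 0 < e <= 1 ->
  ((c * e `^ (- Q))%:E * mu (cell nu (r * e)) <= mu (ball (C * r)))%E].
Proof.
have [c [C [c0 C0 H]]] := quasiball_packing N_quasinorm.
exists c, C; split=> // r e r0 e01.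
have /andP[e0 e1] := e01.
have [K [x [Kc inC inj]]] := H e e01.
apply: (@le_trans _ _ (K%:R%:E * mu (cell nu (r * e)))%E).
  by rewrite lee_wpmul2r// lee_fin.
have dE k y : hmul G (dilation nu r (x k)) y
    = dilation nu r (hmul G (x k) (dilation nu r^-1 y)).
  by rewrite hdilM// dilationVK.
apply: (@measure_ge_packing _ (borelRV R n) _ mu _
  (fun k => hmul G (dilation nu r (x k)) @` cell nu (r * e))).
- exact: quasiball_borel.
- by move=> k; apply: translate_borel; exact: cell_borel.
- by move=> k; apply: (haar_left_invariant mu_haar); exact: cell_borel.
- move=> k _ [y /dilation_cell cy <-]; rewrite dE /quasiball/= (quasinormZ N_quasinorm)//.
  by rewrite mulrC ltr_pM2r// inC//; exact: cy.
- move=> k k' _ [y /dilation_cell cy <-] [y' /dilation_cell cy']; rewrite !dE.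
  move=> /(can_inj (dilationK nu r0)) /esym; apply: inj; [exact: cy|exact: cy'].
Qed.

Lemma cell_quasiball : exists2 c, 0 < c & forall r, 0 < r ->
  cell nu r `<=` ball (c * r).
Proof.
have [M M0 HM] := compact_bounded_above (@unit_box_compact R n)
  (quasinorm_continuous N_quasinorm).
exists (M + 1) => [|r r0 y]; first by rewrite addr_gt0.
rewrite -{1}[r]mulr1 => /dilation_cell cy.
rewrite -(dilationVK nu r0 y) /quasiball/= (quasinormZ N_quasinorm)// mulrC ltr_pM2r//.
rewrite ltr_pwDr// HM//=; apply: (@cell_unit_box _ _ G 1); first by rewrite ltr01 lexx.
exact: cy.
Qed.

Lemma quasiball_lty r : (mu (ball r) < +oo)%E.
Proof.
have cK : compact [set x | N x <= r] by exact: (closed_quasiball_compact N_quasinorm).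
apply: (le_lt_trans _ (haar_compact mu_haar cK)).
apply: le_measure; rewrite ?inE; first exact: quasiball_borel.
- rewrite (_ : [set x | N x <= r] = setT `&` N @^-1` `]-oo, r]%classic).
    exact: quasinorm_borel.
  by apply/seteqP; split => [x xr|x [_]]; [split=> //|]; rewrite /= in_itv.
- by move=> x /ltW.
Qed.

Lemma cell_lty r : 0 < r -> (mu (cell nu r) < +oo)%E.
Proof.
have [c c0 H] := cell_quasiball; move=> r0.
apply: (le_lt_trans _ (quasiball_lty (c * r))).
by apply: le_measure; rewrite ?inE; [exact: cell_borel|exact: quasiball_borel|exact: H].
Qed.

(** If the unit ball were null, so would be every ball, by covering. *)
Lemma quasiball_measure_gt0 : (0 < mu (ball 1))%E.
Proof.
rewrite lt0e measure_ge0 andbT; apply/negP => /eqP V0.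
apply: (haar_neq0 mu_haar).
have [c c0 Hc] := quasiball_cover_measure.
have [d d0 Hd] := cell_quasiball.
have cell0 : mu (cell nu d^-1) = 0%E.
  apply/eqP; rewrite eq_le measure_ge0 andbT -V0.
  apply: le_measure; rewrite ?inE; [exact: cell_borel|exact: quasiball_borel|].
  by have := Hd d^-1; rewrite mulfV ?gt_eqF// invr_gt0; apply.
have ball0 r : d^-1 <= r -> mu (ball r) = 0%E.
  move=> dr; have r0 : 0 < r by rewrite (lt_le_trans _ dr)// invr_gt0.
  apply/eqP; rewrite eq_le measure_ge0 andbT.
  have E : r * (d^-1 / r) = d^-1 by rewrite mulrC divfK// gt_eqF.
  have := Hc r (d^-1 / r) r0; rewrite E cell0 mule0; apply.
  by rewrite divr_gt0 ?invr_gt0//= ler_pdivrMr// mul1r.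
have -> : [set: borelRV R n] = \bigcup_k ball (d^-1 + k%:R).
  apply/seteqP; split => // x _; exists (Num.truncn (N x)).+1 => //.
  rewrite /quasiball/=.
  have /truncn_itv/andP[_] := quasinorm_ge0 N_quasinorm x.
  by move=> /lt_le_trans; apply; rewrite lerDr invr_ge0 ltW.
apply/(@measure_negligible _ (borelRV R n)).
  by apply: bigcupT_measurable => k; exact: quasiball_borel.
apply: negligible_bigcup => k; apply/negligibleP; first exact: quasiball_borel.
by apply: ball0; rewrite lerDl.
Qed.

(** Balls of radius [r] have measure of the order of [r `^ Q]. *)
Lemma quasiball_volume : exists a b, [/\ 0 < a, 0 < b &
  forall r, 0 < r -> ((a * r `^ Q)%:E <= mu (ball r) <= (b * r `^ Q)%:E)%E].
Proof.
have [c c0 Hc] := quasiball_cover_measure.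
have [d d0 Hd] := cell_quasiball.
have [c' [C [c'0 C0 Hp]]] := quasiball_packing_measure.
(* For [s <= 1] a ball of radius 1 is compared with cells of size [s]; for
   [s >= 1] a ball of radius [s] is compared with cells of size 1. *)
pose V r := fine (mu (ball r)).
pose m r := fine (mu (cell nu r)).
have VE r : mu (ball r) = (V r)%:E.
  by rewrite /V fineK// ge0_fin_numE// quasiball_lty.
have mE r : 0 < r -> mu (cell nu r) = (m r)%:E.
  by move=> r0; rewrite /m fineK// ge0_fin_numE// cell_lty.
have V0 r : 0 <= V r by rewrite -lee_fin -VE.
have V1 : 0 < V 1 by rewrite -lte_fin -VE quasiball_measure_gt0.
have mV s : 0 < s -> m s <= V (d * s).
  move=> s0; rewrite -lee_fin -VE -mE//.
  by apply: le_measure; rewrite ?inE; [exact: cell_borel|exact: quasiball_borel|exact: Hd].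
have Vle r s : r <= s -> V r <= V s.
  move=> rs; rewrite -lee_fin -!VE.
  apply: le_measure; rewrite ?inE; [exact: quasiball_borel|exact: quasiball_borel|].
  by move=> x /lt_le_trans; apply.
have cover r e : 0 < r -> 0 < e <= 1 -> V r <= c * e `^ (- Q) * m (r * e).
  move=> r0 e01; have := Hc r e r0 e01; rewrite VE mE ?mulr_gt0//.
  by case/andP: e01.
have pack r e : 0 < r -> 0 < e <= 1 -> c' * e `^ (- Q) * m (r * e) <= V (C * r).
  move=> r0 e01; have := Hp r e r0 e01; rewrite VE mE ?mulr_gt0//.
  by case/andP: e01.
have powK s : 0 < s -> s `^ (- Q) * s `^ Q = 1.
  by move=> s0; rewrite -powRD ?addNr ?powRr0// (gt_eqF s0) implybT.
have powV s : 0 < s -> (s^-1) `^ (- Q) = s `^ Q.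
  by move=> s0; rewrite -powR_inv1 ?(ltW s0)// -powRrM mulN1r opprK.
have m1 : 0 < m 1.
  have := cover 1 1 ltr01; rewrite ltr01 lexx mulr1 => /(_ isT).
  move=> /(lt_le_trans V1); rewrite pmulr_rgt0// mulr_gt0// powR_gt0//.
pose D := Num.max C d.
have D0 : 0 < D by rewrite lt_max C0.
pose a := Num.min (V 1 / c) (c' * m 1).
have a0 : 0 < a by rewrite lt_min divr_gt0//= mulr_gt0.
pose b := Num.max (c / c' * V C) (c * m 1).
have b0 : 0 < b by rewrite lt_max [X in _ || X]mulr_gt0// orbT.
have low s : 0 < s -> a * s `^ Q <= V (D * s).
  move=> s0; have sQ0 : 0 < s `^ Q by rewrite powR_gt0.
  have [s1|s1] := leP s 1.
    apply: (@le_trans _ _ (V 1 / c * s `^ Q)).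
      by rewrite ler_pM2r// /a ge_min lexx.
    have := cover 1 s ltr01; rewrite s0 s1 mul1r => /(_ isT) H.
    apply: (@le_trans _ _ (m s)).
      rewrite mulrAC ler_pdivrMr//.
      have := ler_wpM2r (ltW sQ0) H.
      have -> : c * s `^ (- Q) * m s * s `^ Q = m s * c * (s `^ (- Q) * s `^ Q).
        by ring.
      by rewrite powK// mulr1.
    rewrite (le_trans (mV _ s0))// Vle// ler_pM2r// /D le_max lexx orbT//.
  have := pack s s^-1 s0; rewrite invr_gt0 s0 invf_le1// (ltW s1) => /(_ isT).
  rewrite powV// mulfV ?gt_eqF// mulrAC => H.
  apply: (@le_trans _ _ (V (C * s))).
    by apply: le_trans H; rewrite ler_pM2r// /a ge_min lexx orbT.
  by rewrite Vle// ler_pM2r// /D le_max lexx.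
have upp s : 0 < s -> V s <= b * s `^ Q.
  move=> s0; have sQ0 : 0 < s `^ Q by rewrite powR_gt0.
  have [s1|s1] := leP s 1.
    apply: (@le_trans _ _ (c / c' * V C * s `^ Q)); last first.
      by rewrite ler_pM2r// /b le_max lexx.
    have := cover s 1 s0; rewrite ltr01 lexx mulr1 => /(_ isT).
    rewrite (_ : 1 `^ (- Q) = 1) ?powR1// mulr1 => /le_trans; apply.
    rewrite -!mulrA ler_pM2l//.
    have := pack 1 s ltr01; rewrite s0 s1 mul1r mulr1 => /(_ isT) H.
    rewrite mulrC ler_pdivlMr//.
    have := ler_wpM2r (ltW sQ0) H.
    have -> : c' * s `^ (- Q) * m s * s `^ Q = m s * c' * (s `^ (- Q) * s `^ Q).
      by ring.
    by rewrite powK// mulr1.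
  apply: (@le_trans _ _ (c * m 1 * s `^ Q)); last first.
    by rewrite ler_pM2r// /b le_max lexx orbT.
  have := cover s s^-1 s0; rewrite invr_gt0 s0 invf_le1// (ltW s1) => /(_ isT).
  by rewrite powV// mulfV ?gt_eqF// mulrAC.
exists (a * D `^ (- Q)), b; split=> // [|r r0].
  by rewrite mulr_gt0// powR_gt0.
rewrite VE !lee_fin upp// andbT.
have := low (D^-1 * r); rewrite mulr_gt0 ?invr_gt0// => /(_ isT).
rewrite mulrA mulfV ?gt_eqF// mul1r powRM ?invr_ge0 ?(ltW D0) ?(ltW r0)//.
have -> : D^-1 `^ Q = D `^ (- Q).
  by rewrite -powR_inv1 ?(ltW D0)// -powRrM mulN1r.
by rewrite mulrA.
Qed.

End volume.
(** * Power weights on a space of homogeneous growth *)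

Lemma powR_itv (R : realType) (s t y e : R) : 0 < s -> s <= y <= t ->
  Num.min (s `^ e) (t `^ e) <= y `^ e <= Num.max (s `^ e) (t `^ e).
Proof.
move=> s0 /andP[sy yt]; have y0 := lt_le_trans s0 sy; have t0 := lt_le_trans y0 yt.
have [e0|e0] := leP 0 e.
  rewrite ge_min le_max; apply/andP; split; apply/orP; [left|right].
    by rewrite ge0_ler_powR ?nnegrE ?(ltW s0) ?(ltW y0).
  by rewrite ge0_ler_powR ?nnegrE ?(ltW y0) ?(ltW t0).
have anti u v : 0 < u -> u <= v -> v `^ e <= u `^ e.
  move=> u0 uv; have v0 := lt_le_trans u0 uv.
  rewrite -(opprK e) !(powRN _ (- e)) lef_pV2 ?posrE ?powR_gt0//.
  by rewrite ge0_ler_powR ?nnegrE ?(ltW u0) ?(ltW v0)// oppr_ge0 ltW.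
rewrite ge_min le_max; apply/andP; split; apply/orP; [right|left]; exact: anti.
Qed.

Lemma powR_shift (R : realType) (x e f : R) : 0 < x -> x `^ e * x `^ f = x `^ (e + f).
Proof. by move=> x0; rewrite powRD// (gt_eqF x0) implybT. Qed.

Lemma powR_exprn (R : realType) (u e : R) k : 0 <= u ->
  (u `^ e) ^+ k = (u ^+ k) `^ e.
Proof.
by move=> u0; rewrite -powR_mulrn ?powR_ge0// -powRrM mulrC powRrM powR_mulrn.
Qed.

Lemma conjugate_exponent (R : realType) (p p' : R) : 1 < p -> p^-1 + p'^-1 = 1 ->
  [/\ 1 < p', p * p' = p + p' & (p' - 1) * (p - 1) = 1].
Proof.
move=> p1 E; have p0 : 0 < p by rewrite (lt_trans _ p1).
have pV1 : p^-1 < 1 by rewrite invf_lt1.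
have p'0 : 0 < p' by rewrite -invr_gt0 -(ltrD2l p^-1) addr0 E.
have M : p * p' = p + p'.
  have /(congr1 (fun u => p * p' * u)) := E.
  rewrite mulr1 mulrDr mulrAC mulfV ?gt_eqF// mul1r -mulrA mulfV ?gt_eqF// mulr1.
  by rewrite addrC.
split=> //; first by rewrite -invf_lt1// -E ltrDr invr_gt0.
by move: M; lra.
Qed.

Lemma powR_unbounded (R : realType) (D c r C : R) : 0 < D -> 0 < c -> 0 < r ->
  ~ (forall j : nat, D * (c * j%:R) `^ r <= C).
Proof.
move=> D0 c0 r0 H; pose y := (`|C| + 1) / D.
have y0 : 0 < y by rewrite divr_gt0// ltr_wpDl.
have z0 : 0 <= y `^ r^-1 / c by rewrite divr_ge0 ?powR_ge0 ?ltW.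
pose j := (Num.truncn (y `^ r^-1 / c)).+1.
have /andP[_] := truncn_itv z0; rewrite ltr_pdivrMr// mulrC -/j => /ltW jH.
have : y <= (c * j%:R) `^ r.
  have -> : y = (y `^ r^-1) `^ r by rewrite -powRrM mulVf ?gt_eqF// powRr1// ltW.
  have cj0 : 0 <= c * j%:R by rewrite mulr_ge0// ltW.
  by rewrite ge0_ler_powR ?nnegrE ?powR_ge0 ?(ltW r0).
rewrite -(ler_pM2l D0) /y mulrC divfK ?gt_eqF// => /le_trans/(_ (H j)).
by have := ler_norm C; lra.
Qed.

Lemma powR_bounded_eq0 (R : realType) (D s C : R) : 0 < D ->
  (forall r, 0 < r -> D * r `^ s <= C) -> s = 0.
Proof.
move=> D0 H; apply/eqP/negPn/negP => s0; pose y := (`|C| + 1) / D.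
have y0 : 0 < y by rewrite divr_gt0// ltr_wpDl.
have := H (y `^ s^-1); rewrite powR_gt0// => /(_ isT).
rewrite -powRrM mulVf// powRr1 ?(ltW y0)// /y mulrC divfK ?gt_eqF//.
by have := ler_norm C; lra.
Qed.

Lemma ler_pM3 (R : realType) (x y z x' y' z' : R) :
  0 <= x <= x' -> 0 <= y <= y' -> 0 <= z <= z' -> x * y * z <= x' * y' * z'.
Proof.
move=> /andP[x0 xx] /andP[y0 yy] /andP[z0 zz].
by apply: ler_pM => //; [exact: mulr_ge0|exact: ler_pM].
Qed.

Lemma powR_le_nneg (R : realType) (x y e : R) : 0 <= x -> 0 <= e -> x <= y ->
  0 <= x `^ e <= y `^ e.
Proof.
move=> x0 e0 xy; rewrite powR_ge0/= ge0_ler_powR ?nnegrE//.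
exact: le_trans xy.
Qed.

(** A union of disjoint sets over which the integrals decrease geometrically. *)
Lemma integral_bigcup_geometric d (T : measurableType d) (R : realType)
    (mu : {measure set T -> \bar R}) (F : nat -> set T) (f : T -> \bar R) (c q : R) :
  (forall k, measurable (F k)) -> trivIset setT F -> measurable_fun setT f ->
  (forall x, 0 <= f x)%E -> 0 <= c -> 0 <= q < 1 ->
  (forall k, \int[mu]_(x in F k) f x <= (c * q ^+ k)%:E)%E ->
  (\int[mu]_(x in \bigcup_k F k) f x <= (c / (1 - q))%:E)%E.
Proof.
move=> mF tF mf f0 c0 /andP[q0 q1] H.
rewrite ge0_integral_bigcup//; last exact: measurable_funS mf.
apply: lime_le.
  by apply: is_cvg_nneseries => k _ _; exact: integral_ge0.
apply: nearW => k.
apply: (@le_trans _ _ (\sum_(0 <= i < k) (c * q ^+ i)%:E)%E).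
  by apply: lee_sum => i _; exact: H.
rewrite sumEFin lee_fin ler_pdivlMr ?subr_gt0//.
have -> : (\sum_(0 <= i < k) c * q ^+ i) * (1 - q) = c * (1 - q ^+ k).
  elim: k => [|k IH]; first by rewrite big_nil mul0r expr0 subrr mulr0.
  by rewrite big_nat_recr//= mulrDl IH exprS; ring.
by rewrite ler_piMr// lerBlDr lerDl exprn_ge0.
Qed.

(** A measure space with a nonnegative function [N] whose sublevel sets have
    measure of the order of [r `^ Q]. *)
Section gauge.
Context d (T : measurableType d) (R : realType) (mu : {measure set T -> \bar R}).
Context (N : T -> R) (mN : measurable_fun setT N) (N0 : forall x, 0 <= N x).
Context (Q a b : R) (Q0 : 0 < Q) (a0 : 0 < a) (b0 : 0 < b).
Hypothesis volume : forall r, 0 < r ->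
  ((a * r `^ Q)%:E <= mu [set x | (N x < r)%R] <= (b * r `^ Q)%:E)%E.

Lemma gauge_measurable (D : set R) : measurable D -> measurable (N @^-1` D).
Proof. by move=> mD; rewrite -[X in measurable X]setTI; exact: mN. Qed.

Lemma gaugeball_measurable r : measurable [set x | N x < r].
Proof.
rewrite (_ : [set x | N x < r] = N @^-1` `]-oo, r[%classic).
  exact: gauge_measurable.
by apply/seteqP; split => x; rewrite /= in_itv.
Qed.

(** The points whose gauge lies between [s] included and [t] excluded. *)
Definition shell s t := [set x | s <= N x < t].

Lemma shell_measurable s t : measurable (shell s t).
Proof.
rewrite (_ : shell s t = N @^-1` `[s, t[%classic).
  exact: gauge_measurable.
by apply/seteqP; split => x; rewrite /= in_itv.
Qed.

Lemma gauge_eq0_measure : mu [set x | N x = 0] = 0%E.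
Proof.
have mZ : measurable [set x | N x = 0].
  rewrite (_ : [set x | N x = 0] = N @^-1` [set 0]) //.
  exact: gauge_measurable.
have H r : 0 < r -> (mu [set x | N x = 0%R] <= (b * r `^ Q)%:E)%E.
  move=> r0; apply: (@le_trans _ _ (mu [set x | N x < r])); last first.
    by case/andP: (volume r0).
  apply: le_measure; rewrite ?inE//; first exact: gaugeball_measurable.
  by move=> x /= ->.
apply/eqP; rewrite eq_le measure_ge0 andbT; apply/lee_addgt0Pr => e e0.
rewrite add0e; have := H ((e / b) `^ Q^-1); rewrite powR_gt0 ?divr_gt0// => /(_ isT).
rewrite -powRrM mulVf ?gt_eqF// powRr1 ?divr_ge0 ?(ltW e0) ?(ltW b0)//.
by rewrite mulrC divfK// gt_eqF.
Qed.

Lemma gauge_powR_measurable (D : set T) e : measurable_fun D (fun x => (N x `^ e)%:E).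
Proof.
apply: measurable_funTS; apply/measurable_EFinP.
by apply: (measurableT_comp (measurable_powR e)).
Qed.

Lemma gauge_powR_ge0 e x : (0 <= (N x `^ e)%:E)%E.
Proof. by rewrite lee_fin powR_ge0. Qed.

Local Hint Resolve gauge_powR_measurable gauge_powR_ge0 shell_measurable : core.

Lemma shell_integral_le e s t : 0 < s -> s <= t ->
  (\int[mu]_(x in shell s t) (N x `^ e)%:E <=
   (Num.max (s `^ e) (t `^ e) * (b * t `^ Q))%:E)%E.
Proof.
move=> s0 st; have t0 := lt_le_trans s0 st.
set M := Num.max _ _.
have M0 : 0 <= M by rewrite le_max powR_ge0.
apply: (@le_trans _ _ (\int[mu]_(x in shell s t) cst M%:E x)%E).
  apply: ge0_le_integral => //= x /andP[sx xt]; rewrite lee_fin.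
  have sxt : s <= N x <= t by rewrite sx ltW.
  by have /andP[] := powR_itv e s0 sxt.
rewrite integral_cst// EFinM lee_wpmul2l ?lee_fin//.
have /andP[_ V] := volume t0; apply: le_trans V.
by apply: le_measure; rewrite ?inE//; [exact: gaugeball_measurable|move=> x /andP[]].
Qed.

(** Integrals of integrable power weights over balls. *)
Lemma inner_integral_le e : 0 < e + Q -> exists2 c, 0 < c & forall r, 0 < r ->
  (\int[mu]_(x in [set x | (0 < N x < r)%R]) (N x `^ e)%:E <= (c * r `^ (e + Q))%:E)%E.
Proof.
move=> eQ; pose q := 2^-1 `^ (e + Q) : R.
have q0 : 0 < q by rewrite powR_gt0// invr_gt0.
have q1 : q < 1.
  have := @gt0_ltr_powR R (e + Q) eQ 2^-1 1.
  by rewrite powR1; apply; rewrite ?nnegrE// invf_lt1// ltr1n.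
pose M := Num.max (2^-1 `^ e) 1 * b : R.
have M0 : 0 < M by rewrite mulr_gt0// lt_max ltr01 orbT.
exists (M / (1 - q)) => [|r r0]; first by rewrite divr_gt0// subr_gt0.
pose s k := 2^-1 ^+ k * r.
have s0 k : 0 < s k by rewrite mulr_gt0// exprn_gt0.
have sS k : s k.+1 = 2^-1 * s k by rewrite /s exprS mulrA.
have sD j k : s (j + k)%N <= s j.
  rewrite /s exprD ler_pM2r// ler_piMr// ?exprn_ge0// exprn_ile1// invf_le1//.
  by rewrite ler1n.
(* Dyadic shells shrinking to the origin. *)
pose F k := shell (s k.+1) (s k).
have -> : [set x | 0 < N x < r] = \bigcup_k F k.
  apply/seteqP; split => [x /andP[x0 xr]|x [k _] /andP[x1 x2]]; last first.
    apply/andP; split; first exact: lt_le_trans x1.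
    by apply: lt_le_trans x2 _; have := sD 0%N k; rewrite /s expr0 mul1r add0n.
  have [k kx] : exists k, s k <= N x.
    pose k := Num.truncn (r / N x); exists k.
    have /andP[_ H] := truncn_itv (ltW (divr_gt0 r0 x0)).
    rewrite /s exprVn mulrC ler_pdivrMr ?exprn_gt0//.
    move: H; rewrite ltr_pdivrMr// -/k => /ltW /le_trans; apply.
    rewrite mulrC ler_pM2l// -natrX ler_nat; exact: ltn_expl.
  have /ex_minnP[m mx mmin] : exists k, s k <= N x by exists k.
  case: m mx mmin => [|m] mx mmin.
    by move: mx; rewrite /s expr0 mul1r leNgt xr.
  exists m => //; apply/andP; split => //; rewrite ltNge; apply/negP => /mmin.
  by rewrite ltnn.
have tF : trivIset setT F.
  have H j k x : (j < k)%N -> F j x -> F k x -> False.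
    move=> jk /andP[x1 _] /andP[_ x2].
    have := sD j.+1 (k - j.+1)%N; rewrite subnKC// => /(lt_le_trans x2).
    by rewrite ltNge x1.
  move=> j k _ _ [x [Fj Fk]].
  by have [jk|kj|//] := ltngtP j k; [case: (H j k x)|case: (H k j x)].
rewrite mulrAC; apply: integral_bigcup_geometric => //.
- by move=> k; exact: shell_measurable.
- by rewrite mulr_ge0 ?powR_ge0// ltW.
- by rewrite ltW.
move=> k; apply: le_trans (shell_integral_le _ (s0 _) _) _.
  by have := sD k 1%N; rewrite addn1.
rewrite lee_fin le_eqVlt; apply/orP; left; apply/eqP.
have -> : q ^+ k = (2^-1 ^+ k) `^ (e + Q) by rewrite /q powR_exprn.
rewrite sS powRM ?(ltW (s0 _))//.
rewrite -[X in Num.max _ X]mul1r -maxr_pMl ?powR_ge0// /M.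
rewrite -!mulrA; congr (_ * _).
rewrite mulrCA powR_shift//; congr (_ * _).
by rewrite mulrC -powRM ?exprn_ge0 ?ltW.
Qed.

(** Integrals of integrable power weights over complements of balls. *)
Lemma outer_integral_le e : e + Q < 0 -> exists2 c, 0 < c & forall r, 0 < r ->
  (\int[mu]_(x in [set x | (r <= N x)%R]) (N x `^ e)%:E <= (c * r `^ (e + Q))%:E)%E.
Proof.
move=> eQ; pose q := 2 `^ (e + Q) : R.
have q0 : 0 < q by rewrite powR_gt0.
have q1 : q < 1.
  rewrite /q -(opprK (e + Q)) powRN invf_lt1 ?powR_gt0//.
  have := @gt0_ltr_powR R (- (e + Q)) _ 1 2.
  by rewrite oppr_gt0 powR1; apply; rewrite ?nnegrE// ltr1n.
pose M := Num.max 1 (2 `^ e) * (b * 2 `^ Q) : R.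
have M0 : 0 < M by rewrite !mulr_gt0 ?powR_gt0// lt_max ltr01.
exists (M / (1 - q)) => [|r r0]; first by rewrite divr_gt0// subr_gt0.
pose s k := 2 ^+ k * r.
have s0 k : 0 < s k by rewrite mulr_gt0// exprn_gt0.
have sS k : s k.+1 = 2 * s k by rewrite /s exprS mulrA.
have sD j k : s j <= s (j + k)%N.
  rewrite /s exprD ler_pM2r// ler_peMr// ?exprn_ge0// exprn_ege1//.
  by rewrite ler1n.
(* Dyadic shells going to infinity. *)
pose F k := shell (s k) (s k.+1).
have -> : [set x | r <= N x] = \bigcup_k F k.
  apply/seteqP; split => [x rx|x [k _] /andP[x1 x2]]; last first.
    by apply: le_trans x1; have := sD 0%N k; rewrite /s expr0 mul1r add0n.
  have [k kx] : exists k, N x < s k.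
    pose k := (Num.truncn (N x / r)).+1; exists k.
    have /andP[_ H] := truncn_itv (divr_ge0 (N0 x) (ltW r0)).
    move: H; rewrite ltr_pdivrMr// -/k => /lt_le_trans; apply.
    rewrite /s ler_pM2r// -natrX ler_nat; exact/ltnW/ltn_expl.
  have /ex_minnP[m mx mmin] : exists k, N x < s k by exists k.
  case: m mx mmin => [|m] mx mmin.
    by move: mx; rewrite /s expr0 mul1r ltNge rx.
  exists m => //; apply/andP; split => //; rewrite leNgt; apply/negP => /mmin.
  by rewrite ltnn.
have tF : trivIset setT F.
  have H j k x : (j < k)%N -> F j x -> F k x -> False.
    move=> jk /andP[_ x1] /andP[x2 _].
    have := sD j.+1 (k - j.+1)%N; rewrite subnKC// => /(lt_le_trans x1).
    by rewrite ltNge x2.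
  move=> j k _ _ [x [Fj Fk]].
  by have [jk|kj|//] := ltngtP j k; [case: (H j k x)|case: (H k j x)].
rewrite mulrAC; apply: integral_bigcup_geometric => //.
- by move=> k; exact: shell_measurable.
- by rewrite mulr_ge0 ?powR_ge0// ltW.
- by rewrite ltW.
move=> k; apply: le_trans (shell_integral_le _ (s0 _) _) _.
  by have := sD k 1%N; rewrite addn1.
rewrite lee_fin le_eqVlt; apply/orP; left; apply/eqP.
have -> : q ^+ k = (2 ^+ k) `^ (e + Q) by rewrite /q powR_exprn.
rewrite sS !(powRM _ (ler0n _ 2) (ltW (s0 _))).
rewrite -[X in Num.max X _]mul1r -maxr_pMl ?powR_ge0// /M.
have sE : (2 ^+ k) `^ (e + Q) * r `^ (e + Q) = s k `^ e * s k `^ Q.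
  by rewrite powR_shift// powRM ?exprn_ge0 ?(ltW r0).
rewrite -[RHS]mulrA (mulrC (r `^ _)) sE; ring.
Qed.

(** Shells of a fixed ratio [K], common to all exponents, have weighted measure
    bounded below by a power of their radius. *)
Lemma shell_integral_ge : exists2 K, 1 < K & forall e, exists2 c, 0 < c &
  forall s, 0 < s ->
  ((c * s `^ (e + Q))%:E <= \int[mu]_(x in shell s (K * s)%R) (N x `^ e)%:E)%E.
Proof.
have ab : a <= b.
  have := volume (@ltr01 R); rewrite powR1 !mulr1 => /andP[H1 H2].
  by have := le_trans H1 H2; rewrite lee_fin.
(* With this ratio the larger ball has at least twice the upper bound for the
   measure of the smaller one. *)
pose K := (2 * b / a) `^ Q^-1.
have KQ : a * K `^ Q = 2 * b.
  rewrite /K -powRrM mulVf ?gt_eqF// powRr1; last by rewrite divr_ge0 ?mulr_ge0 ?ltW.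
  by rewrite mulrC divfK// gt_eqF.
have K0 : 0 < K by rewrite powR_gt0// divr_gt0// mulr_gt0.
have K1 : 1 < K.
  rewrite ltNge; apply/negP => K1.
  have : K `^ Q <= 1 `^ Q by rewrite ge0_ler_powR ?nnegrE ?(ltW Q0) ?(ltW K0).
  rewrite powR1 -(ler_pM2l a0) KQ mulr1; move: ab b0; lra.
exists K => // e; exists (Num.min 1 (K `^ e) * b) => [|s s0].
  by rewrite mulr_gt0// lt_min ltr01 powR_gt0.
have Ks : s <= K * s by rewrite ler_peMl// ltW.
pose M := Num.min (s `^ e) ((K * s) `^ e).
have M0 : 0 <= M by rewrite le_min !powR_ge0.
apply: (@le_trans _ _ (\int[mu]_(x in shell s (K * s)%R) cst M%:E x)%E); last first.
  apply: ge0_le_integral => //= x /andP[sx xt]; rewrite lee_fin.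
  have sxt : s <= N x <= K * s by rewrite sx ltW.
  by have /andP[] := powR_itv e s0 sxt.
rewrite integral_cst//.
have ms : ((b * s `^ Q)%:E <= mu (shell s (K * s)%R))%E.
  have [mlo mup] := (volume (mulr_gt0 K0 s0), volume s0).
  have mB t : measurable [set x | N x < t] by exact: gaugeball_measurable.
  have : (mu [set x | (N x < K * s)%R] <= mu [set x | (N x < s)%R] + mu (shell s (K * s)%R))%E.
    apply: le_trans (measureU2 _ _ _) => //.
    apply: le_measure; rewrite ?inE//; first exact: measurableU.
    by move=> x /= xK; have [sx|xs] := leP s (N x); [right; apply/andP|left].
  move: mlo mup => /andP[lo _] /andP[_ up].
  move=> /(le_trans lo) H; have := le_trans H (leeD2r _ up).
  rewrite powRM ?(ltW K0) ?(ltW s0)// mulrA KQ.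
  rewrite -leeBlDl// -EFinB.
  by rewrite (_ : 2 * b * s `^ Q - b * s `^ Q = b * s `^ Q)//; ring.
apply: le_trans (lee_wpmul2l _ ms); last by rewrite lee_fin.
have ME : M = Num.min 1 (K `^ e) * s `^ e.
  by rewrite minr_pMl ?powR_ge0// mul1r /M powRM ?(ltW K0) ?(ltW s0).
rewrite -EFinM lee_fin ME -(powR_shift _ _ s0) le_eqVlt.
by apply/orP; left; apply/eqP; ring.
Qed.

(** * Measurability of integrals over balls *)

Lemma gauge_sigma_finite : sigma_finite setT mu.
Proof.
exists (fun k => [set x | N x < k.+1%:R]).
  apply/seteqP; split => // x _; exists (Num.truncn (N x)) => //=.
  by have /andP[_] := truncn_itv (N0 x).
move=> k; split; first exact: gaugeball_measurable.
have /andP[_ V] := volume (ltr0Sn R k); exact: le_lt_trans V (ltry _).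
Qed.

(* [mu] bundled with its sigma-finiteness. *)
Let smu : {sigma_finite_measure set T -> \bar R} :=
  HB.pack_for {sigma_finite_measure set T -> \bar R} (Measure.sort mu)
    (isSFinite.Build _ _ _ _ (sfinite_measure_sigma_finite gauge_sigma_finite))
    (isSigmaFinite.Build _ _ _ _ gauge_sigma_finite).

Section nonnegative_function.
Variables (f : T -> R) (mf : measurable_fun setT f) (f0 : forall x, 0 <= f x).

Lemma below_measurable : measurable_fun setT (fun z : T * T => (N z.2 < N z.1)%R%:R : R).
Proof.
pose D := [set z : T * T | N z.2 < N z.1].
have mD : measurable D.
  rewrite (_ : D = setT `&` (fun z : T * T => N z.1 - N z.2) @^-1` `]0, +oo[%classic).
    apply: measurable_funB => //.
      by apply: (measurableT_comp mN); exact: measurable_fst.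
    by apply: (measurableT_comp mN); exact: measurable_snd.
  by apply/seteqP; split => [z zD|z [_]]; [split=> //|]; rewrite /= in_itv/= andbT subr_gt0.
rewrite (_ : (fun z : T * T => _) = \1_D); first exact: measurable_indic.
apply/funext => z; rewrite indicE; congr (_%:R); congr nat_of_bool.
by apply/idP/idP; rewrite inE.
Qed.

Lemma below_kernel_measurable (g : T -> R) : measurable_fun setT g ->
  measurable_fun setT (fun z : T * T => (g z.2 * (N z.2 < N z.1)%R%:R)%:E).
Proof.
move=> mg; apply/measurable_EFinP; apply: measurable_funM; last exact: below_measurable.
by apply: (measurableT_comp mg); exact: measurable_snd.
Qed.

Lemma ball_integralE x :
  (\int[mu]_(y in [set y | (N y < N x)%R]) (f y)%:E =
   \int[mu]_y (f y * (N y < N x)%R%:R)%:E)%E.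
Proof.
rewrite integral_mkcond; apply: eq_integral => y _; rewrite patchE.
case: ifPn => [|/negP]; rewrite inE/=; first by move=> ->; rewrite mulr1.
by move=> /negP/negbTE ->; rewrite mulr0.
Qed.

Lemma ball_integral_measurable :
  measurable_fun setT (fun x => \int[mu]_(y in [set y | (N y < N x)%R]) (f y)%:E)%E.
Proof.
have /= := @measurable_fun_fubini_tonelli_F _ _ T T R smu _ (below_kernel_measurable mf).
rewrite (_ : fubini_F _ _ = fun x => \int[mu]_(y in [set y | (N y < N x)%R]) (f y)%:E)%E.
  by apply => z; rewrite lee_fin mulr_ge0.
by apply/funext => x; rewrite ball_integralE.
Qed.

End nonnegative_function.

(** * Necessity of the conditions *)

(** The bilinear Hardy inequality for nonnegative real functions. *)
Definition bilinear_hardy (p1 p2 q alpha beta1 beta2 C : R) : Prop :=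
  forall f1 f2 : T -> R, measurable_fun setT f1 -> measurable_fun setT f2 ->
  (forall x, 0 <= f1 x) -> (forall x, 0 <= f2 x) ->
  ((\int[mu]_x
      ((\int[mu]_(y in [set y | (N y < N x)%R]) (f1 y)%:E *
        \int[mu]_(y in [set y | (N y < N x)%R]) (f2 y)%:E) `^ q
       * (N x `^ alpha)%:E)) `^ q^-1
   <= C%:E * (\int[mu]_x ((f1 x)%:E `^ p1 * (N x `^ beta1)%:E)) `^ p1^-1
           * (\int[mu]_x ((f2 x)%:E `^ p2 * (N x `^ beta2)%:E)) `^ p2^-1)%E.

(** The integral of the weight [N `^ e] over a shell, as a real number. *)
Definition shellint e s t : R :=
  fine (\int[mu]_(x in shell s t) (N x `^ e)%:E)%E.

Lemma shellintE e s t : 0 < s -> s <= t ->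
  (\int[mu]_(x in shell s t) (N x `^ e)%:E = (shellint e s t)%:E)%E.
Proof.
move=> s0 st; rewrite /shellint fineK// ge0_fin_numE.
  exact: le_lt_trans (shell_integral_le _ s0 st) (ltry _).
by apply: integral_ge0 => x _; exact: gauge_powR_ge0.
Qed.

Lemma shellint_ge0 e s t : 0 <= shellint e s t.
Proof. by apply: fine_ge0; apply: integral_ge0 => x _; exact: gauge_powR_ge0. Qed.

Lemma shellintD e s t u : 0 < s -> s <= t -> t <= u ->
  shellint e s u = shellint e s t + shellint e t u.
Proof.
move=> s0 st tu; have t0 := lt_le_trans s0 st; have su := le_trans st tu.
apply: EFin_inj; rewrite EFinD -!shellintE// -ge0_integral_setU//.
- congr integral; apply/seteqP; split => [x /andP[sx xu]|x].
    by have [xt|xt] := ltP (N x) t; [left|right]; apply/andP.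
  case=> /andP[x1 x2]; apply/andP; split => //.
    exact: lt_le_trans tu.
  exact: le_trans st _.
- apply/disj_setPS => x [/andP[_ x1] /andP[x2 _]].
  by move: x1; rewrite ltNge x2.
Qed.

Lemma shellint_lower_bound : exists2 K, 1 < K & forall e, exists2 c, 0 < c &
  forall s, 0 < s -> c * s `^ (e + Q) <= shellint e s (K * s).
Proof.
have [K K1 H] := shell_integral_ge; exists K => // e; have [c c0 Hc] := H e.
exists c => // s s0; rewrite -lee_fin -shellintE//; first exact: Hc.
by rewrite ler_peMl// ltW.
Qed.

(** Integrals over outer shells grow linearly in the number of shells when the
    weight is not integrable at infinity. *)
Lemma shellint_grow_out e K c : 1 < K -> 0 <= c ->
  (forall s, 0 < s -> c * s `^ (e + Q) <= shellint e s (K * s)) ->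
  0 <= e + Q -> forall j : nat, c * j%:R <= shellint e 1 (K ^+ j).
Proof.
move=> K1 c0 H eQ; have K0 : 0 < K by rewrite (lt_trans _ K1).
elim=> [|j IH]; first by rewrite mulr0 shellint_ge0.
have Kj : 1 <= K ^+ j by rewrite exprn_ege1// ltW.
rewrite (@shellintD _ _ (K ^+ j))//; last by rewrite ler_eXn2l.
rewrite -natr1 mulrDr mulr1 lerD// exprS.
apply: le_trans (H _ (lt_le_trans ltr01 Kj)).
by rewrite ler_peMr// -(powRr0 (K ^+ j)) ler_powR.
Qed.

(** Integrals over inner shells grow linearly in the number of shells when the
    weight is not integrable at the origin. *)
Lemma shellint_grow_in e K c : 1 < K -> 0 <= c ->
  (forall s, 0 < s -> c * s `^ (e + Q) <= shellint e s (K * s)) ->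
  e + Q <= 0 -> forall j : nat, c * j%:R <= shellint e (K ^- j) 1.
Proof.
move=> K1 c0 H eQ; have K0 : 0 < K by rewrite (lt_trans _ K1).
elim=> [|j IH]; first by rewrite mulr0 shellint_ge0.
have Kj i : 0 < K ^- i <= 1.
  by rewrite invr_gt0 exprn_gt0//= invf_le1 ?exprn_gt0// exprn_ege1// ltW.
have [/andP[Kj0 Kj1] /andP[KS0 KS1]] := (Kj j, Kj j.+1).
have KE : K * K ^- j.+1 = K ^- j.
  by rewrite exprS invfM mulrA mulfV ?mul1r// gt_eqF.
rewrite (@shellintD _ _ (K ^- j))//; last by rewrite -KE ler_peMl ?ltW.
rewrite -natr1 mulrDr mulr1 addrC lerD//.
have HS := H _ KS0; rewrite KE in HS; apply: le_trans HS.
by rewrite ler_peMr// -[leLHS](powRr0 (K ^- j.+1)) ger_powR// KS0.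
Qed.

(** The test functions: a power of the gauge restricted to a shell. *)
Definition shellfun e s t : T -> R := fun x => N x `^ e * \1_(shell s t) x.

Lemma shellfun_ge0 e s t x : 0 <= shellfun e s t x.
Proof. by rewrite mulr_ge0 ?powR_ge0. Qed.

Lemma shellfun_measurable e s t : measurable_fun setT (shellfun e s t).
Proof.
apply: measurable_funM; last exact: measurable_indic.
by apply: (measurableT_comp (measurable_powR e)).
Qed.

(** When [e * p + beta = e], the weighted norm of the test function, raised to
    the power [p], is the integral of [N `^ e] over the shell. *)
Lemma shellfun_norm e s t p beta : 0 < s -> s <= t -> 0 < p -> e * p + beta = e ->
  (\int[mu]_x ((shellfun e s t x)%:E `^ p * (N x `^ beta)%:E) = (shellint e s t)%:E)%E.
Proof.
move=> s0 st p0 E; rewrite -shellintE// [RHS]integral_mkcond.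
apply: eq_integral => x _; rewrite patchE /shellfun indicE.
have [xs|xs] := boolP (x \in shell s t).
  have /andP[sx _] := set_mem xs.
  rewrite mulr1 poweR_EFin -EFinM -powRrM powR_shift ?E//.
  exact: lt_le_trans sx.
by rewrite mulr0 poweR0r ?mul0e// gt_eqF.
Qed.

Lemma shellfun_ball e s t x : 0 < s -> s <= t -> t <= N x ->
  ((shellint e s t)%:E <=
    \int[mu]_(y in [set y | (N y < N x)%R]) (shellfun e s t y)%:E)%E.
Proof.
move=> s0 st tx; rewrite -shellintE//.
apply: (@le_trans _ _ (\int[mu]_(y in shell s t) (shellfun e s t y)%:E)%E).
  rewrite le_eqVlt; apply/orP; left; apply/eqP; apply: eq_integral => y ys.
  by rewrite /shellfun indicE ys mulr1.
apply: ge0_subset_integral => //; first exact: gaugeball_measurable.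
- apply: measurable_funTS; apply/measurable_EFinP; exact: shellfun_measurable.
- by move=> y _; rewrite lee_fin shellfun_ge0.
- by move=> y /andP[_ yt]; exact: lt_le_trans tx.
Qed.

Section necessity.
Variables (p1 p2 p1' p2' q alpha beta1 beta2 C : R).
Hypotheses (p1_gt1 : 1 < p1) (p2_gt1 : 1 < p2) (q0 : 0 < q).
Hypotheses (p1_conj : p1^-1 + p1'^-1 = 1) (p2_conj : p2^-1 + p2'^-1 = 1).
Hypothesis hardy : bilinear_hardy p1 p2 q alpha beta1 beta2 C.

Let g1 := beta1 * (1 - p1').
Let g2 := beta2 * (1 - p2').

(** The inequality tested on the shell from [s] to [t], evaluated at the points
    of the shell from [t] to [u]. *)
Lemma hardy_shell s t u : 0 < s -> s <= t -> t <= u ->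
  shellint g1 s t * shellint g2 s t * shellint alpha t u `^ q^-1 <=
  C * shellint g1 s t `^ p1^-1 * shellint g2 s t `^ p2^-1.
Proof.
move=> s0 st tu; have t0 := lt_le_trans s0 st.
have [p1'1 _ c1] := conjugate_exponent p1_gt1 p1_conj.
have [p2'1 _ c2] := conjugate_exponent p2_gt1 p2_conj.
have := hardy (shellfun_measurable g1 s t) (shellfun_measurable g2 s t)
  (shellfun_ge0 g1 s t) (shellfun_ge0 g2 s t).
have E1 : g1 * p1 + beta1 = g1.
  have : beta1 * (1 - (p1' - 1) * (p1 - 1)) = 0 by rewrite c1 subrr mulr0.
  by rewrite /g1; lra.
have E2 : g2 * p2 + beta2 = g2.
  have : beta2 * (1 - (p2' - 1) * (p2 - 1)) = 0 by rewrite c2 subrr mulr0.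
  by rewrite /g2; lra.
rewrite (shellfun_norm s0 st (lt_trans ltr01 p1_gt1) E1).
rewrite (shellfun_norm s0 st (lt_trans ltr01 p2_gt1) E2).
rewrite !poweR_EFin -!EFinM -lee_fin; apply: le_trans.
set I1 := shellint g1 s t; set I2 := shellint g2 s t.
have I10 : 0 <= I1 := shellint_ge0 _ _ _.
have I20 : 0 <= I2 := shellint_ge0 _ _ _.
have -> : ((I1 * I2 * shellint alpha t u `^ q^-1)%:E =
    (((I1 * I2) `^ q)%:E * \int[mu]_(x in shell t u) (N x `^ alpha)%:E) `^ q^-1)%E.
  rewrite shellintE// -EFinM poweR_EFin (powRM _ (powR_ge0 _ _) (shellint_ge0 _ _ _)).
  by rewrite -powRrM mulfV ?gt_eqF// powRr1// mulr_ge0.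
have mH (i : R) := ball_integral_measurable (shellfun_measurable i s t) (shellfun_ge0 i s t).
have H0 i x : (0 <= \int[mu]_(y in [set y | (N y < N x)%R]) (shellfun i s t y)%:E)%E.
  by apply: integral_ge0 => y _; rewrite lee_fin shellfun_ge0.
have mI : measurable_fun setT (fun x : T =>
      ((\int[mu]_(y in [set y | (N y < N x)%R]) (shellfun g1 s t y)%:E *
        \int[mu]_(y in [set y | (N y < N x)%R]) (shellfun g2 s t y)%:E) `^ q
       * (N x `^ alpha)%:E)%E).
  apply: emeasurable_funM => //.
  apply: (measurableT_comp (measurable_poweR q)).
  by apply: emeasurable_funM; exact: mH.
apply: gt0_ler_poweR; first by rewrite invr_ge0 ltW.
- rewrite in_itv/= leey andbT mule_ge0 ?lee_fin ?powR_ge0//.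
  by apply: integral_ge0 => x _; exact: gauge_powR_ge0.
- rewrite in_itv/= leey andbT; apply: integral_ge0 => x _.
  by rewrite mule_ge0 ?poweR_ge0 ?gauge_powR_ge0.
rewrite -ge0_integralZl_EFin ?powR_ge0//.
apply: (@le_trans _ _ (\int[mu]_(x in shell t u)
      ((\int[mu]_(y in [set y | (N y < N x)%R]) (shellfun g1 s t y)%:E *
        \int[mu]_(y in [set y | (N y < N x)%R]) (shellfun g2 s t y)%:E) `^ q
       * (N x `^ alpha)%:E))%E); last first.
  apply: ge0_subset_integral => // x _.
  by rewrite mule_ge0 ?poweR_ge0 ?gauge_powR_ge0.
apply: ge0_le_integral => //.
- by move=> x _; rewrite mule_ge0 ?lee_fin ?powR_ge0.
- by apply: emeasurable_funM => //.
- exact: measurable_funTS mI.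
move=> x /andP[tx _]; apply: lee_wpmul2r; first exact: gauge_powR_ge0.
rewrite -poweR_EFin; apply: gt0_ler_poweR; first exact: ltW.
- by rewrite in_itv/= leey andbT lee_fin mulr_ge0.
- by rewrite in_itv/= leey andbT mule_ge0.
by rewrite EFinM; apply: lee_pmul; rewrite ?lee_fin// shellfun_ball.
Qed.

(** The same with the norms moved to the left-hand side. *)
Lemma hardy_shell_pos s t u : 0 < s -> s <= t -> t <= u ->
  0 < shellint g1 s t -> 0 < shellint g2 s t ->
  shellint g1 s t `^ p1'^-1 * shellint g2 s t `^ p2'^-1
    * shellint alpha t u `^ q^-1 <= C.
Proof.
move=> s0 st tu I10 I20; have := hardy_shell s0 st tu.
have E (I p p' : R) : p^-1 + p'^-1 = 1 -> 0 < I -> I = I `^ p^-1 * I `^ p'^-1.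
  by move=> pp I0; rewrite powR_shift// pp powRr1// ltW.
rewrite {1}(E _ _ _ p1_conj I10) {1}(E _ _ _ p2_conj I20).
have cancel (P P' A A' X Y : R) : 0 < P -> 0 < P' ->
    P * A * (P' * A') * X <= Y * P * P' -> A * A' * X <= Y.
  move=> P0 P'0 H; rewrite -(@ler_pM2r _ (P * P')) ?mulr_gt0// [leRHS]mulrA.
  by apply: le_trans H; rewrite le_eqVlt; apply/orP; left; apply/eqP; ring.
by apply: cancel; exact: powR_gt0.
Qed.

Lemma hardy_necessary :
  [/\ alpha + Q < 0, 0 < g1 + Q & 0 < g2 + Q] /\
  (alpha + Q) / q + (g1 + Q) / p1' + (g2 + Q) / p2' = 0.
Proof.
have [p1'1 _ _] := conjugate_exponent p1_gt1 p1_conj.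
have [p2'1 _ _] := conjugate_exponent p2_gt1 p2_conj.
have p1'0 : 0 < p1' by rewrite (lt_trans _ p1'1).
have p2'0 : 0 < p2' by rewrite (lt_trans _ p2'1).
have [K K1 low] := shellint_lower_bound.
have K0 : 0 < K by rewrite (lt_trans _ K1).
have [c1 c10 H1] := low g1.
have [c2 c20 H2] := low g2.
have [c3 c30 H3] := low alpha.
have KV0 : 0 < K^-1 by rewrite invr_gt0.
have KV1 : K^-1 <= 1 by rewrite invf_le1// ltW.
have pos e c : 0 < c ->
    (forall s, 0 < s -> c * s `^ (e + Q) <= shellint e s (K * s)) ->
    forall s, 0 < s -> 0 < shellint e s (K * s).
  by move=> c0 H s s0; apply: lt_le_trans (H s s0); rewrite mulr_gt0// powR_gt0.
have posV e c : 0 < c ->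
    (forall s, 0 < s -> c * s `^ (e + Q) <= shellint e s (K * s)) ->
    0 < shellint e K^-1 1.
  by move=> c0 H; rewrite -[X in shellint _ _ X](@mulfV _ K) ?gt_eqF//; exact: pos H _ _.
have KSV j : K ^- j.+1 <= K^-1 by rewrite lef_pV2 ?posrE ?exprn_gt0// ler_eXnr// ltW.
have grow e c j : 0 < c ->
    (forall s, 0 < s -> c * s `^ (e + Q) <= shellint e s (K * s)) ->
    shellint e K^-1 1 <= shellint e (K ^- j.+1) 1.
  move=> c0 H; rewrite (@shellintD e (K ^- j.+1) K^-1 1)//.
    by rewrite lerDr shellint_ge0.
  by rewrite invr_gt0 exprn_gt0.
have A0 := pos _ _ c30 H3 1 ltr01; rewrite mulr1 in A0.
have I10 := posV _ _ c10 H1.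
have I20 := posV _ _ c20 H2.
split; first split.
- rewrite ltNge; apply/negP => aQ.
  have D0 : 0 < shellint g1 K^-1 1 `^ p1'^-1 * shellint g2 K^-1 1 `^ p2'^-1.
    by rewrite mulr_gt0// powR_gt0.
  apply: (@powR_unbounded _ _ c3 q^-1 C D0 c30); first by rewrite invr_gt0.
  move=> j; have Kj : 1 <= K ^+ j by rewrite exprn_ege1// ltW.
  apply: le_trans (hardy_shell_pos KV0 KV1 Kj I10 I20).
  apply: ler_pM3; [by rewrite lexx powR_ge0|by rewrite lexx powR_ge0|].
  apply: powR_le_nneg; first by rewrite mulr_ge0// ltW.
    by rewrite invr_ge0 ltW.
  exact: shellint_grow_out K1 (ltW c30) H3 aQ j.
- rewrite ltNge; apply/negP => aQ.
  have D0 : 0 < shellint g2 K^-1 1 `^ p2'^-1 * shellint alpha 1 K `^ q^-1.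
    by rewrite mulr_gt0// powR_gt0.
  apply: (@powR_unbounded _ _ c1 p1'^-1 C D0 c10); first by rewrite invr_gt0.
  move=> j; have Kj0 : 0 < K ^- j.+1 by rewrite invr_gt0 exprn_gt0.
  have J1 := lt_le_trans I10 (grow _ _ j c10 H1).
  have J2 := lt_le_trans I20 (grow _ _ j c20 H2).
  apply: le_trans (hardy_shell_pos Kj0 (le_trans (KSV j) KV1) (ltW K1) J1 J2).
  rewrite [leLHS]mulrC [leLHS]mulrA.
  apply: ler_pM3; last by rewrite lexx powR_ge0.
    apply: powR_le_nneg; first by rewrite mulr_ge0// ltW.
      by rewrite invr_ge0 ltW.
    apply: le_trans (shellint_grow_in K1 (ltW c10) H1 aQ j.+1).
    by rewrite ler_pM2l// ler_nat.
  apply: powR_le_nneg; first exact: shellint_ge0.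
    by rewrite invr_ge0 ltW.
  exact: grow H2.
- rewrite ltNge; apply/negP => aQ.
  have D0 : 0 < shellint g1 K^-1 1 `^ p1'^-1 * shellint alpha 1 K `^ q^-1.
    by rewrite mulr_gt0// powR_gt0.
  apply: (@powR_unbounded _ _ c2 p2'^-1 C D0 c20); first by rewrite invr_gt0.
  move=> j; have Kj0 : 0 < K ^- j.+1 by rewrite invr_gt0 exprn_gt0.
  have J1 := lt_le_trans I10 (grow _ _ j c10 H1).
  have J2 := lt_le_trans I20 (grow _ _ j c20 H2).
  apply: le_trans (hardy_shell_pos Kj0 (le_trans (KSV j) KV1) (ltW K1) J1 J2).
  rewrite [leLHS]mulrAC.
  apply: ler_pM3; last by rewrite lexx powR_ge0.
    apply: powR_le_nneg; first exact: shellint_ge0.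
      by rewrite invr_ge0 ltW.
    exact: grow H1.
  apply: powR_le_nneg; first by rewrite mulr_ge0// ltW.
    by rewrite invr_ge0 ltW.
  apply: le_trans (shellint_grow_in K1 (ltW c20) H2 aQ j.+1).
  by rewrite ler_pM2l// ler_nat.
pose D := c1 `^ p1'^-1 * c2 `^ p2'^-1 * (c3 * K `^ (alpha + Q)) `^ q^-1.
apply: (@powR_bounded_eq0 _ D _ C).
  by rewrite !mulr_gt0 ?powR_gt0// mulr_gt0// powR_gt0.
move=> r r0; have Kr0 : 0 < K * r by rewrite mulr_gt0.
have rKr : r <= K * r by rewrite ler_peMl// ltW.
have KrK : K * r <= K * (K * r) by rewrite ler_peMl// ltW.
apply: le_trans (hardy_shell_pos r0 rKr KrK (pos _ _ c10 H1 r r0) (pos _ _ c20 H2 r r0)).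
have bnd c e p I : 0 < c -> 0 < p -> c * r `^ e <= I ->
    c `^ p^-1 * r `^ (e / p) <= I `^ p^-1.
  move=> c0 p0 cI; rewrite powRrM -powRM ?powR_ge0 ?(ltW c0)//.
  have cr0 : 0 <= c * r `^ e by rewrite mulr_ge0 ?powR_ge0// ltW.
  by rewrite ge0_ler_powR ?nnegrE ?invr_ge0 ?(ltW p0)// (le_trans cr0).
have c3K0 : 0 < c3 * K `^ (alpha + Q) by rewrite mulr_gt0// powR_gt0.
have H3' : c3 * K `^ (alpha + Q) * r `^ (alpha + Q) <= shellint alpha (K * r) (K * (K * r)).
  by apply: le_trans (H3 _ Kr0); rewrite powRM ?(ltW K0) ?(ltW r0)// mulrA.
have B1 := bnd _ _ _ _ c10 p1'0 (H1 r r0).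
have B2 := bnd _ _ _ _ c20 p2'0 (H2 r r0).
have B3 := bnd _ _ _ _ c3K0 q0 H3'.
have -> : D * r `^ ((alpha + Q) / q + (g1 + Q) / p1' + (g2 + Q) / p2') =
    (c1 `^ p1'^-1 * r `^ ((g1 + Q) / p1')) * (c2 `^ p2'^-1 * r `^ ((g2 + Q) / p2')) *
    ((c3 * K `^ (alpha + Q)) `^ q^-1 * r `^ ((alpha + Q) / q)).
  rewrite -!(powR_shift _ _ r0) /D; ring.
have pp (x y e f : R) : 0 <= x `^ e * y `^ f by rewrite mulr_ge0 ?powR_ge0.
have lepp (x y e f z : R) : x `^ e * y `^ f <= z -> 0 <= x `^ e * y `^ f <= z.
  by rewrite pp.
exact: (ler_pM3 (lepp _ _ _ _ _ B1) (lepp _ _ _ _ _ B2) (lepp _ _ _ _ _ B3)).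
Qed.

End necessity.

(** * Sufficiency of the conditions *)

(** The weighted Hoelder inequality on centered balls, where the integral of the
    dual weight is replaced by its power of the radius. *)
Lemma ball_hoelder p p' e : 1 < p -> p^-1 + p'^-1 = 1 -> e * p' < Q ->
  exists2 c, 0 < c & forall f : T -> R, measurable_fun setT f ->
    (forall x, 0 <= f x) -> forall r, 0 < r ->
  (\int[mu]_(y in [set y | (N y < r)%R]) (f y)%:E <= c%:E *
    (\int[mu]_(y in [set y | (N y < r)%R]) (f y `^ p * N y `^ (e * p))%:E) `^ p^-1
    * (r `^ (Q / p' - e))%:E)%E.
Proof.
move=> p_gt1 pp eQ.
have [p'_gt1 _ _] := conjugate_exponent p_gt1 pp.
have p0 : 0 < p by rewrite (lt_trans _ p_gt1).
have p'0 : 0 < p' by rewrite (lt_trans _ p'_gt1).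
have eQ' : 0 < - (e * p') + Q by rewrite addrC subr_gt0.
have [c c0 Hc] := inner_integral_le eQ'.
exists (c `^ p'^-1) => [|f mf f0 r r0]; first by rewrite powR_gt0.
pose D := [set y | 0 < N y < r].
have mD : measurable D.
  rewrite (_ : D = N @^-1` `]0, r[%classic); first exact: gauge_measurable.
  by apply/seteqP; split => x; rewrite /D /= in_itv.
(* The factors live on the ball minus the null set where the gauge vanishes, so
   that the two weights cancel. *)
pose h1 y := f y * N y `^ e * \1_D y.
pose h2 y := N y `^ (- e) * \1_D y.
have mpow u : measurable_fun setT (fun y => N y `^ u).
  exact: (measurableT_comp (measurable_powR u) mN).
have mh1 : measurable_fun setT h1.
  apply: measurable_funM; last exact: measurable_indic.
  by apply: measurable_funM => //; exact: mpow.
have mh2 : measurable_fun setT h2.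
  by apply: measurable_funM; [exact: mpow|exact: measurable_indic].
have h10 y : 0 <= h1 y by rewrite !mulr_ge0 ?powR_ge0.
have h20 y : 0 <= h2 y by rewrite mulr_ge0 ?powR_ge0.
have -> : (\int[mu]_(y in [set y | (N y < r)%R]) (f y)%:E = \int[mu]_y (h1 y * h2 y)%:E)%E.
  rewrite (@ge0_negligible_integral _ _ _ _ _ [set y | N y = 0]); last 5 first.
  - rewrite (_ : [set y | N y = 0] = N @^-1` [set 0])//; exact: gauge_measurable.
  - exact: gaugeball_measurable.
  - by apply: measurable_funTS; exact/measurable_EFinP.
  - by move=> y _; rewrite lee_fin.
  - exact: gauge_eq0_measure.
  have -> : [set y | N y < r] `\` [set y | N y = 0] = D.
    apply/seteqP; split => [y [/= yr /eqP y0]|y /andP[y0 yr]].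
      by rewrite /D/= yr andbT lt_neqAle eq_sym y0 N0.
    by split=> //=; apply/eqP; rewrite gt_eqF.
  rewrite integral_mkcond; apply: eq_integral => y _; rewrite patchE /h1 /h2 indicE.
  have [yD|yD] := boolP (y \in D); last by rewrite !mulr0.
  have /andP[y0 _] := set_mem yD.
  by rewrite !mulr1 -mulrA powR_shift// subrr powRr0 mulr1.
have := hoelder mu mh1 mh2 p0 p'0 pp.
have NE (u : R) (h : T -> R) : (forall y, 0 <= h y) ->
    (Lnorm mu u%:E (EFin \o h) = (\int[mu]_y (h y `^ u)%:E) `^ u^-1)%E.
  move=> h0; rewrite unlock; apply: (congr1 (fun z => z `^ u^-1)%E).
  by apply: eq_integral => y _; rewrite -poweR_EFin gee0_abs// lee_fin.
rewrite Lnorm1 (NE p _ h10) (NE p' _ h20).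
have -> : (\int[mu]_x `|(EFin \o (h1 \* h2)%R) x| = \int[mu]_y (h1 y * h2 y)%:E)%E.
  by apply: eq_integral => y _ /=; rewrite ger0_norm// mulr_ge0.
move=> /le_trans; apply.
rewrite (muleC (c `^ _)%:E) -muleA; apply: lee_pmul; rewrite ?poweR_ge0//.
- apply: gt0_ler_poweR; first by rewrite invr_ge0 ltW.
  + by rewrite in_itv/= leey andbT; apply: integral_ge0 => y _; rewrite lee_fin powR_ge0.
  + rewrite in_itv/= leey andbT; apply: integral_ge0 => y _.
    by rewrite lee_fin mulr_ge0 ?powR_ge0.
  rewrite [leRHS]integral_mkcond; apply: ge0_le_integral => //.
  + by move=> y _; rewrite lee_fin powR_ge0.
  + by apply/measurable_EFinP; exact: (measurableT_comp (measurable_powR p)).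
  + apply/(measurable_restrictT _ (gaugeball_measurable r)).
    apply: measurable_funTS; apply/measurable_EFinP; apply: measurable_funM => //.
    by apply: (measurableT_comp (measurable_powR p)).
  move=> y _; rewrite patchE /h1 indicE.
  have [yD|yD] := boolP (y \in D).
    have /andP[y0 yr] := set_mem yD.
    rewrite ifT; last by rewrite inE.
    by rewrite mulr1 lee_fin powRM ?powR_ge0// -powRrM.
  rewrite mulr0 powR0 ?gt_eqF//; case: ifP => // _.
  by rewrite lee_fin mulr_ge0 ?powR_ge0.
have -> : ((c `^ p'^-1)%:E * (r `^ (Q / p' - e))%:E = ((c * r `^ (- (e * p') + Q))%:E) `^ p'^-1)%E.
  rewrite -EFinM poweR_EFin powRM ?powR_ge0 ?(ltW c0)// -powRrM.
  do 3 f_equal; field; exact: lt0r_neq0.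
apply: gt0_ler_poweR; first by rewrite invr_ge0 ltW.
- by rewrite in_itv/= leey andbT; apply: integral_ge0 => y _; rewrite lee_fin powR_ge0.
- by rewrite in_itv/= leey andbT lee_fin mulr_ge0 ?powR_ge0 ?(ltW c0).
apply: le_trans (Hc r r0); rewrite le_eqVlt; apply/orP; left; apply/eqP.
rewrite [RHS]integral_mkcond; apply: eq_integral => y _.
rewrite patchE /h2 indicE -/D.
have [yD|yD] := boolP (y \in D); last by rewrite mulr0 powR0// gt_eqF.
by rewrite mulr1 -powRrM mulNr.
Qed.

(** The linear Hardy inequality with equal exponents. *)
Lemma linear_hardy p p' beta : 1 < p -> p^-1 + p'^-1 = 1 ->
  let s := Q / p' - beta / p in 0 < s ->
  exists2 c, 0 < c & forall f : T -> R, measurable_fun setT f ->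
    (forall x, 0 <= f x) ->
  (\int[mu]_x ((\int[mu]_(y in [set y | (N y < N x)%R]) (f y)%:E) `^ p
      * (N x `^ (- Q - p * s))%:E)
   <= c%:E * \int[mu]_y (f y `^ p * N y `^ beta)%:E)%E.
Proof.
move=> p_gt1 pp s s0.
have [p'_gt1 _ _] := conjugate_exponent p_gt1 pp.
have p0 : 0 < p by rewrite (lt_trans _ p_gt1).
have p'0 : 0 < p' by rewrite (lt_trans _ p'_gt1).
(* The auxiliary weight [N `^ e] makes both the inner norm over the ball and
   the outer integral over its complement converge. *)
have [e [e0 be eQ]] : exists e, [/\ 0 < e, beta / p < e & e < Q / p'].
  have Qp0 : 0 < Q / p' by rewrite divr_gt0.
  exists ((Num.max 0 (beta / p) + Q / p') / 2).
  have m1 : 0 <= Num.max 0 (beta / p) by rewrite le_max lexx.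
  have m2 : beta / p <= Num.max 0 (beta / p) by rewrite le_max lexx orbT.
  have m3 : Num.max 0 (beta / p) < Q / p' by rewrite gt_max Qp0/= -subr_gt0.
  by split; lra.
have [c c0 Hc] : exists2 c, 0 < c & forall f : T -> R, measurable_fun setT f ->
    (forall x, 0 <= f x) -> forall r, 0 < r ->
  (\int[mu]_(y in [set y | (N y < r)%R]) (f y)%:E <= c%:E *
    (\int[mu]_(y in [set y | (N y < r)%R]) (f y `^ p * N y `^ (e * p))%:E) `^ p^-1
    * (r `^ (Q / p' - e))%:E)%E.
  by apply: ball_hoelder => //; rewrite -ltr_pdivlMr.
pose h := beta - p * e - Q.
have hQ : h + Q < 0.
  have : beta < e * p by rewrite -ltr_pdivrMr.
  by rewrite /h; lra.
have [c2 c20 Hc2] := outer_integral_le hQ.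
have cp0 : 0 < c `^ p * c2 by rewrite mulr_gt0// powR_gt0.
exists (c `^ p * c2) => // f mf f0.
pose g y := f y `^ p * N y `^ (e * p).
have g0 y : 0 <= g y by rewrite mulr_ge0 ?powR_ge0.
have mg : measurable_fun setT g.
  apply: measurable_funM; first exact: (measurableT_comp (measurable_powR p)).
  exact: (measurableT_comp (measurable_powR (e * p)) mN).
pose k z := N z.1 `^ h * (g z.2 * (N z.2 < N z.1)%R%:R) : R.
have k0 z : 0 <= k z by rewrite !mulr_ge0 ?powR_ge0.
have mk : measurable_fun setT (fun z : T * T => (k z)%:E).
  apply/measurable_EFinP; apply: measurable_funM.
    apply: (measurableT_comp (measurable_powR h)).
    by apply: (measurableT_comp mN); exact: measurable_fst.
  by apply/measurable_EFinP; exact: below_kernel_measurable.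
(* The product of the inner integral and of the outer weight, written as a
   partial integral of [k]; Tonelli's theorem then exchanges the variables. *)
have gk x : (\int[mu]_y (k (x, y))%:E =
    (N x `^ h)%:E * \int[mu]_(y in [set y | (N y < N x)%R]) (g y)%:E)%E.
  rewrite ball_integralE -ge0_integralZl_EFin ?powR_ge0//.
  - by move=> y _; rewrite lee_fin mulr_ge0.
  - exact: (measurableT_comp (below_kernel_measurable mg) (pair1_measurable x)).
have mF := ball_integral_measurable mf f0.
apply: (@le_trans _ _ (\int[mu]_x ((c `^ p)%:E * \int[mu]_y (k (x, y))%:E))%E).
  apply: ge0_le_integral => //.
  - by move=> x _; rewrite mule_ge0 ?poweR_ge0 ?gauge_powR_ge0.
  - by apply: emeasurable_funM => //; exact: (measurableT_comp (measurable_poweR p)).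
  - apply: measurable_funeM.
    exact: (@measurable_fun_fubini_tonelli_F _ _ T T R smu _ mk (fun z => _)).
  move=> x _; have := N0 x; rewrite le_eqVlt => /predU1P[x0|x0].
    rewrite (_ : [set y | N y < N x] = set0).
      by rewrite integral_set0 poweR0r ?gt_eqF// mul0e mule_ge0 ?lee_fin ?powR_ge0//;
        apply: integral_ge0 => y _; rewrite lee_fin.
    by apply/seteqP; split => // y /=; rewrite -x0 ltNge N0.
  rewrite gk muleA -EFinM.
  have A0 : (0 <= \int[mu]_(y in [set y | (N y < N x)%R]) (g y)%:E)%E.
    by apply: integral_ge0 => y _; rewrite lee_fin.
  have F0 : (0 <= \int[mu]_(y in [set y | (N y < N x)%R]) (f y)%:E)%E.
    by apply: integral_ge0 => y _; rewrite lee_fin.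
  have HF := Hc f mf f0 (N x) x0; rewrite -/g in HF.
  have {}HF := @gt0_ler_poweR _ p (ltW p0) _ _ _ _ HF.
  apply: (@le_trans _ _ (((c `^ p)%:E *
      \int[mu]_(y in [set y | (N y < N x)%R]) (g y)%:E *
      (N x `^ ((Q / p' - e) * p))%:E) * (N x `^ (- Q - p * s))%:E)%E).
    apply: lee_wpmul2r; first exact: gauge_powR_ge0.
    rewrite (le_trans (HF _ _))//.
    - by rewrite in_itv/= F0 leey.
    - by rewrite in_itv/= leey andbT !mule_ge0 ?lee_fin ?powR_ge0 ?poweR_ge0 ?(ltW c0).
    rewrite poweRM ?mule_ge0 ?lee_fin ?powR_ge0 ?poweR_ge0 ?(ltW c0)//.
    rewrite poweRM ?lee_fin ?poweR_ge0 ?(ltW c0)//.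
    by rewrite -poweRrM mulVf ?gt_eqF// poweRe1// !poweR_EFin -powRrM.
  rewrite -muleA -EFinM powR_shift// muleAC -EFinM.
  have -> : (Q / p' - e) * p + (- Q - p * s) = h.
    by rewrite /h /s; field; apply/andP; split; apply: lt0r_neq0.
  exact: lexx.
rewrite ge0_integralZl_EFin ?powR_ge0//; last 2 first.
- by move=> x _; apply: integral_ge0 => y _; rewrite lee_fin.
- exact: (@measurable_fun_fubini_tonelli_F _ _ T T R smu _ mk (fun z => _)).
have -> : (\int[mu]_x \int[mu]_y (k (x, y))%:E = \int[mu]_y \int[mu]_x (k (x, y))%:E)%E.
  exact: (@fubini_tonelli _ _ T T R smu smu _ mk (fun z => _)).
rewrite EFinM -muleA; apply: lee_wpmul2l; first by rewrite lee_fin powR_ge0.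
rewrite -ge0_integralZl_EFin ?(ltW c20)//; last 2 first.
- by move=> y _; rewrite lee_fin mulr_ge0 ?powR_ge0.
- apply/measurable_EFinP; apply: measurable_funM.
    exact: (measurableT_comp (measurable_powR p)).
  exact: (measurableT_comp (measurable_powR beta) mN).
apply: ge0_le_integral => //.
- by move=> y _; apply: integral_ge0 => x _; rewrite lee_fin.
- exact: (@measurable_fun_fubini_tonelli_G _ _ T T R smu _ mk (fun z => _)).
- apply: measurable_funeM; apply/measurable_EFinP; apply: measurable_funM.
    exact: (measurableT_comp (measurable_powR p)).
  exact: (measurableT_comp (measurable_powR beta) mN).
move=> y _; have := N0 y; rewrite le_eqVlt => /predU1P[y0|y0].
  (* At the origin [g] vanishes, because [e > 0]. *)
  have gy : g y = 0 by rewrite /g -y0 powR0 ?mulr0// gt_eqF// mulr_gt0.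
  rewrite (eq_integral (cst 0%E)) => [|x _]; last by rewrite /k/= gy mul0r mulr0.
  by rewrite integral0 mule_ge0 ?lee_fin ?mulr_ge0 ?powR_ge0 ?(ltW c20).
have -> : (\int[mu]_x (k (x, y))%:E =
    (g y)%:E * \int[mu]_x (N x `^ h * (N y < N x)%R%:R)%:E)%E.
  rewrite -ge0_integralZl_EFin//.
  - by apply: eq_integral => x _; rewrite /k/= mulrCA EFinM.
  - by move=> x _; rewrite lee_fin mulr_ge0 ?powR_ge0.
  - apply/measurable_EFinP; apply: measurable_funM.
      exact: (measurableT_comp (measurable_powR h) mN).
    exact: (measurableT_comp below_measurable (pair2_measurable y)).
have H : (\int[mu]_x (N x `^ h * (N y < N x)%R%:R)%:E <= (c2 * N y `^ (h + Q))%:E)%E.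
  apply: le_trans (Hc2 _ y0); rewrite [leRHS]integral_mkcond.
  have mC : measurable [set x | N y <= N x].
    rewrite (_ : [set x | N y <= N x] = N @^-1` `[N y, +oo[%classic).
      exact: gauge_measurable.
    by apply/seteqP; split => x; rewrite /= in_itv/= andbT.
  apply: ge0_le_integral => //.
  - by move=> x _; rewrite lee_fin mulr_ge0 ?powR_ge0.
  - apply/measurable_EFinP; apply: measurable_funM.
      exact: (measurableT_comp (measurable_powR h) mN).
    exact: (measurableT_comp below_measurable (pair2_measurable y)).
  - by apply/(measurable_restrictT _ mC).
  move=> x _; rewrite patchE; have [yx|xy] := ltP (N y) (N x).
    by rewrite ifT ?mulr1// inE/= ltW.
  by rewrite mulr0; case: ifP => // _; exact: gauge_powR_ge0.
apply: (@le_trans _ _ ((g y)%:E * (c2 * N y `^ (h + Q))%:E)%E).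
  by apply: lee_wpmul2l => //; rewrite lee_fin.
rewrite -!EFinM lee_fin le_eqVlt; apply/orP; left; apply/eqP.
have -> : N y `^ beta = N y `^ (e * p) * N y `^ (h + Q).
  by rewrite powR_shift//; congr (_ `^ _); rewrite /h; ring.
by rewrite /g; ring.
Qed.

(** The exponent of the radius in the bound of the integral over a ball. *)
Lemma critical_exponent p p' beta : 1 < p -> p^-1 + p'^-1 = 1 ->
  (beta * (1 - p') + Q) / p' = Q / p' - beta / p.
Proof.
move=> p_gt1 pp; have [p'_gt1 _ _] := conjugate_exponent p_gt1 pp.
have -> : p^-1 = 1 - p'^-1 by rewrite -pp addrK.
by field; rewrite gt_eqF// (lt_trans _ p'_gt1).
Qed.

(** The pointwise reduction to the linear inequality: only the power [p] of [u]
    is kept, the other factors being replaced by their bounds. *)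
Lemma hardy_pointwise (u v n B1 B2 s1 s2 p q alpha : R) :
  0 <= u -> 0 <= v -> 0 < n -> 0 <= B1 -> 0 <= B2 -> p <= q -> 0 < q ->
  u <= B1 * n `^ s1 -> v <= B2 * n `^ s2 ->
  alpha + s1 * (q - p) + s2 * q = - Q - p * s1 ->
  (u * v) `^ q * n `^ alpha <=
    B1 `^ (q - p) * B2 `^ q * (u `^ p * n `^ (- Q - p * s1)).
Proof.
move=> u0 v0 n0 B10 B20 pq q0 uB vB E.
rewrite powRM//.
have -> : u `^ q = u `^ p * u `^ (q - p).
  by rewrite -powRD subrKC// (gt_eqF q0).
have /andP[_ H1] : 0 <= u `^ (q - p) <= (B1 * n `^ s1) `^ (q - p).
  by apply: powR_le_nneg => //; rewrite subr_ge0.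
have /andP[_ H2] : 0 <= v `^ q <= (B2 * n `^ s2) `^ q.
  by apply: powR_le_nneg => //; exact: ltW.
move: H1 H2; rewrite !powRM ?powR_ge0// -!powRrM => H1 H2.
have -> : n `^ (- Q - p * s1) = n `^ (s1 * (q - p)) * n `^ (s2 * q) * n `^ alpha.
  by rewrite !powR_shift// -E; congr (_ `^ _); ring.
have -> : B1 `^ (q - p) * B2 `^ q * (u `^ p * (n `^ (s1 * (q - p)) * n `^ (s2 * q) * n `^ alpha))
  = u `^ p * (B1 `^ (q - p) * n `^ (s1 * (q - p))) * (B2 `^ q * n `^ (s2 * q)) * n `^ alpha.
  by ring.
apply: ler_wpM2r; first exact: powR_ge0.
apply: ler_pM; [|exact: powR_ge0| |exact: H2].
  by apply: mulr_ge0; exact: powR_ge0.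
by apply: ler_wpM2l; first exact: powR_ge0.
Qed.

(** The constant of the bilinear inequality, from those of its ingredients. *)
Lemma hardy_constant (c1 c2 c A1 A2 p q : R) :
  0 <= c1 -> 0 <= c2 -> 0 <= c -> 0 <= A1 -> 0 <= A2 -> 0 < q ->
  ((c1 * A1) `^ (q - p) * (c2 * A2) `^ q * (c * A1 `^ p)) `^ q^-1 =
  (c1 `^ (q - p) * c2 `^ q * c) `^ q^-1 * A1 * A2.
Proof.
move=> c10 c20 c0 A10 A20 q0.
have -> : (c1 * A1) `^ (q - p) * (c2 * A2) `^ q * (c * A1 `^ p) =
    c1 `^ (q - p) * c2 `^ q * c * A1 `^ q * A2 `^ q.
  have -> : A1 `^ q = A1 `^ (q - p) * A1 `^ p.
    by rewrite -powRD subrK// (gt_eqF q0).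
  by rewrite !powRM//; ring.
have C0 : 0 <= c1 `^ (q - p) * c2 `^ q * c by rewrite !mulr_ge0 ?powR_ge0.
rewrite powRM ?powR_ge0//; last by rewrite mulr_ge0 ?powR_ge0.
rewrite powRM ?powR_ge0// -!(powRrM _ q) mulfV ?gt_eqF//.
by rewrite (powRr1 A10) (powRr1 A20).
Qed.

Lemma ball_integral_bound p p' beta : 1 < p -> p^-1 + p'^-1 = 1 ->
  let s := (beta * (1 - p') + Q) / p' in 0 < s ->
  exists2 c, 0 < c & forall f : T -> R, measurable_fun setT f ->
    (forall x, 0 <= f x) -> forall r, 0 < r ->
  (\int[mu]_(y in [set y | (N y < r)%R]) (f y)%:E <= c%:E *
    (\int[mu]_y (f y `^ p * N y `^ beta)%:E) `^ p^-1 * (r `^ s)%:E)%E.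
Proof.
move=> p_gt1 pp s s0; have [p'_gt1 _ _] := conjugate_exponent p_gt1 pp.
have p0 : 0 < p by rewrite (lt_trans _ p_gt1).
have p'0 : 0 < p' by rewrite (lt_trans _ p'_gt1).
have sE : s = Q / p' - beta / p := critical_exponent _ p_gt1 pp.
have eQ : beta / p * p' < Q by rewrite -ltr_pdivlMr// -subr_gt0 -sE.
have [c c0 Hc] := ball_hoelder p_gt1 pp eQ.
exists c => // f mf f0 r r0; have := Hc f mf f0 r r0.
rewrite divfK ?gt_eqF// -sE => /le_trans; apply.
have mg : measurable_fun setT (fun y => (f y `^ p * N y `^ beta)%:E).
  apply/measurable_EFinP; apply: measurable_funM.
    exact: (measurableT_comp (measurable_powR p)).
  exact: (measurableT_comp (measurable_powR beta) mN).
have g0 y : (0 <= (f y `^ p * N y `^ beta)%:E)%E by rewrite lee_fin mulr_ge0 ?powR_ge0.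
apply: lee_wpmul2r; first by rewrite lee_fin powR_ge0.
apply: lee_wpmul2l; first by rewrite lee_fin ltW.
apply: gt0_ler_poweR; first by rewrite invr_ge0 ltW.
- by rewrite in_itv/= leey andbT integral_ge0.
- by rewrite in_itv/= leey andbT integral_ge0.
by apply: ge0_subset_integral => //; exact: gaugeball_measurable.
Qed.

Lemma hardy_sufficient p1 p2 p1' p2' q alpha beta1 beta2 :
  1 < p1 -> 1 < p2 -> p1^-1 + p1'^-1 = 1 -> p2^-1 + p2'^-1 = 1 -> p1 <= q ->
  0 < beta1 * (1 - p1') + Q -> 0 < beta2 * (1 - p2') + Q ->
  (alpha + Q) / q + (beta1 * (1 - p1') + Q) / p1'
    + (beta2 * (1 - p2') + Q) / p2' = 0 ->
  exists C, bilinear_hardy p1 p2 q alpha beta1 beta2 C.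
Proof.
move=> p1_gt1 p2_gt1 pp1 pp2 p1q b1 b2 bal.
have [p1'_gt1 _ _] := conjugate_exponent p1_gt1 pp1.
have [p2'_gt1 _ _] := conjugate_exponent p2_gt1 pp2.
have p10 : 0 < p1 by rewrite (lt_trans _ p1_gt1).
have p20 : 0 < p2 by rewrite (lt_trans _ p2_gt1).
have q0 : 0 < q := lt_le_trans p10 p1q.
pose s1 := (beta1 * (1 - p1') + Q) / p1'.
pose s2 := (beta2 * (1 - p2') + Q) / p2'.
have s10 : 0 < s1 by rewrite divr_gt0// (lt_trans _ p1'_gt1).
have s20 : 0 < s2 by rewrite divr_gt0// (lt_trans _ p2'_gt1).
have s1E : s1 = Q / p1' - beta1 / p1 := critical_exponent _ p1_gt1 pp1.
have [c1 c10 H1] := ball_integral_bound p1_gt1 pp1 s10.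
have [c2 c20 H2] := ball_integral_bound p2_gt1 pp2 s20.
have s1p : 0 < Q / p1' - beta1 / p1 by rewrite -s1E.
have [c c0 H] := linear_hardy p1_gt1 pp1 s1p.
rewrite -s1E in H.
have exps : alpha + s1 * (q - p1) + s2 * q = - Q - p1 * s1.
  have : ((alpha + Q) / q + s1 + s2) * q = 0 by rewrite /s1 /s2 bal mul0r.
  by rewrite [X in X = _]mulrDl [X in X + _]mulrDl divfK ?gt_eqF//; lra.
pose Cq := c1 `^ (q - p1) * c2 `^ q * c.
have Cq0 : 0 < Cq by rewrite !mulr_gt0 ?powR_gt0.
exists (Cq `^ q^-1) => f1 f2 mf1 mf2 f10 f20.
pose F1 x := (\int[mu]_(y in [set y | (N y < N x)%R]) (f1 y)%:E)%E.
pose F2 x := (\int[mu]_(y in [set y | (N y < N x)%R]) (f2 y)%:E)%E.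
have F10 x : (0 <= F1 x)%E by apply: integral_ge0 => y _; rewrite lee_fin.
have F20 x : (0 <= F2 x)%E by apply: integral_ge0 => y _; rewrite lee_fin.
pose X1 := (\int[mu]_y (f1 y `^ p1 * N y `^ beta1)%:E)%E.
pose X2 := (\int[mu]_y (f2 y `^ p2 * N y `^ beta2)%:E)%E.
suff : ((\int[mu]_x ((F1 x * F2 x) `^ q * (N x `^ alpha)%:E)) `^ q^-1
    <= (Cq `^ q^-1)%:E * X1 `^ p1^-1 * X2 `^ p2^-1)%E by [].
have X10 : (0 <= X1)%E.
  by apply: integral_ge0 => y _; rewrite lee_fin mulr_ge0 ?powR_ge0.
have X20 : (0 <= X2)%E.
  by apply: integral_ge0 => y _; rewrite lee_fin mulr_ge0 ?powR_ge0.
have ball0 x : N x = 0 -> [set y | N y < N x] = set0.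
  by move=> x0; apply/seteqP; split => // y /=; rewrite x0 ltNge N0.
have F1z x : N x = 0 -> F1 x = 0%E by move=> x0; rewrite /F1 ball0// integral_set0.
have F2z x : N x = 0 -> F2 x = 0%E by move=> x0; rewrite /F2 ball0// integral_set0.
have F1bnd x : 0 < N x -> (F1 x <= c1%:E * X1 `^ p1^-1 * (N x `^ s1)%:E)%E.
  by move=> x0; exact: H1.
have F2bnd x : 0 < N x -> (F2 x <= c2%:E * X2 `^ p2^-1 * (N x `^ s2)%:E)%E.
  by move=> x0; exact: H2.
have HF1 : (\int[mu]_x (F1 x `^ p1 * (N x `^ (- Q - p1 * s1))%:E) <= c%:E * X1)%E.
  exact: H.
have mF1 : measurable_fun setT F1 by exact: ball_integral_measurable.
have mF2 : measurable_fun setT F2 by exact: ball_integral_measurable.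
clearbody F1 F2 X1 X2; clear H H1 H2 ball0.
(* If one of the norms vanishes then so does the left-hand side. *)
have zero : (forall x, (F1 x * F2 x = 0)%E) ->
    ((\int[mu]_x ((F1 x * F2 x) `^ q * (N x `^ alpha)%:E)) `^ q^-1 = 0)%E.
  move=> FF; rewrite (eq_integral (cst 0%E)) => [|x _]; last first.
    by rewrite FF poweR0r ?mul0e// gt_eqF.
  by rewrite integral0 poweR0r// invr_eq0 gt_eqF.
have RHS0 : (0 <= (Cq `^ q^-1)%:E * X1 `^ p1^-1 * X2 `^ p2^-1)%E.
  by rewrite !mule_ge0 ?poweR_ge0 ?lee_fin ?powR_ge0.
have [X1z|X1n] := eqVneq X1 0%E.
  rewrite zero// => x; have := N0 x; rewrite le_eqVlt => /predU1P[x0|x0].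
    by rewrite F1z ?mul0e.
  have := F1bnd x x0; rewrite X1z poweR0r ?invr_eq0 ?gt_eqF// mule0 mul0e => F1x.
  by rewrite (_ : F1 x = 0%E) ?mul0e//; apply/eqP; rewrite eq_le F1x F10.
have [X2z|X2n] := eqVneq X2 0%E.
  rewrite zero// => x; have := N0 x; rewrite le_eqVlt => /predU1P[x0|x0].
    by rewrite F1z ?mul0e.
  have := F2bnd x x0; rewrite X2z poweR0r ?invr_eq0 ?gt_eqF// mule0 mul0e => F2x.
  by rewrite (_ : F2 x = 0%E) ?mule0//; apply/eqP; rewrite eq_le F2x F20.
have X1p : (0 < X1 `^ p1^-1)%E by rewrite poweR_gt0// lt0e X1n.
have X2p : (0 < X2 `^ p2^-1)%E by rewrite poweR_gt0// lt0e X2n.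
have Cp : (0 < (Cq `^ q^-1)%:E)%E by rewrite lte_fin powR_gt0.
have [X1y|X1f] := eqVneq X1 +oo%E.
  by rewrite X1y poweRyr ?invr_eq0 ?gt_eqF// gt0_muley// gt0_mulye// leey.
have [X2y|X2f] := eqVneq X2 +oo%E.
  by rewrite X2y poweRyr ?invr_eq0 ?gt_eqF// gt0_muley ?leey// mule_gt0.
have /fineK X1E : X1 \is a fin_num by rewrite ge0_fin_numE// ltey.
have /fineK X2E : X2 \is a fin_num by rewrite ge0_fin_numE// ltey.
pose A1 := fine X1 `^ p1^-1.
pose A2 := fine X2 `^ p2^-1.
have A1E : (X1 `^ p1^-1 = A1%:E)%E by rewrite -X1E poweR_EFin.
have A2E : (X2 `^ p2^-1 = A2%:E)%E by rewrite -X2E poweR_EFin.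
have A10 : 0 <= A1 by exact: powR_ge0.
have A20 : 0 <= A2 by exact: powR_ge0.
pose K := (c1 * A1) `^ (q - p1) * (c2 * A2) `^ q.
have K0 : 0 <= K by rewrite mulr_ge0 ?powR_ge0.
have main : (\int[mu]_x ((F1 x * F2 x) `^ q * (N x `^ alpha)%:E) <=
    (K * (c * A1 `^ p1))%:E)%E.
  apply: (@le_trans _ _ (\int[mu]_x (K%:E *
      ((F1 x) `^ p1 * (N x `^ (- Q - p1 * s1))%:E)))%E).
    apply: ge0_le_integral => //.
    - by move=> x _; rewrite mule_ge0 ?poweR_ge0 ?gauge_powR_ge0.
    - apply: emeasurable_funM => //; apply: (measurableT_comp (measurable_poweR q)).
      exact: emeasurable_funM.
    - apply: measurable_funeM; apply: emeasurable_funM => //.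
      exact: (measurableT_comp (measurable_poweR p1)).
    move=> x _; have := N0 x; rewrite le_eqVlt => /predU1P[x0|x0].
      rewrite {1}F1z// mul0e poweR0r ?gt_eqF// mul0e.
      by rewrite !mule_ge0 ?lee_fin ?poweR_ge0 ?powR_ge0.
    have := F1bnd x x0; have := F2bnd x x0; rewrite A1E A2E -!EFinM => B2 B1.
    have /fineK E1 : F1 x \is a fin_num.
      by rewrite ge0_fin_numE//; exact: le_lt_trans B1 (ltry _).
    have /fineK E2 : F2 x \is a fin_num.
      by rewrite ge0_fin_numE//; exact: le_lt_trans B2 (ltry _).
    rewrite -E1 lee_fin in B1; rewrite -E2 lee_fin in B2.
    rewrite -E1 -E2 -EFinM !poweR_EFin -!EFinM lee_fin.
    apply: (hardy_pointwise _ _ _ _ _ _ _ B1 B2 exps) => //.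
    - exact: fine_ge0.
    - exact: fine_ge0.
    - by rewrite mulr_ge0// ltW.
    - by rewrite mulr_ge0// ltW.
  rewrite ge0_integralZl_EFin//; last 2 first.
  - by move=> x _; rewrite mule_ge0 ?poweR_ge0 ?gauge_powR_ge0.
  - by apply: emeasurable_funM => //; exact: (measurableT_comp (measurable_poweR p1)).
  rewrite (EFinM K); apply: lee_wpmul2l; first by rewrite lee_fin.
  rewrite (EFinM c) (_ : A1 `^ p1 = fine X1).
    by rewrite X1E; exact: HF1.
  by rewrite -powRrM mulVf ?gt_eqF// powRr1// fine_ge0.
rewrite A1E A2E -!EFinM.
rewrite /Cq -(hardy_constant p1 (ltW c10) (ltW c20) (ltW c0) A10 A20 q0) -/K.
rewrite -poweR_EFin; apply: gt0_ler_poweR; first by rewrite invr_ge0 ltW.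
- rewrite in_itv/= leey andbT; apply: integral_ge0 => x _.
  by rewrite mule_ge0 ?poweR_ge0 ?gauge_powR_ge0.
- by rewrite in_itv/= leey andbT lee_fin !mulr_ge0 ?powR_ge0 ?(ltW c0).
exact: main.
Qed.

End gauge.

(** * The inequality on the group *)

Section complex_functions.
Context (R : realType) (n : nat).
Implicit Types f : borelRV R n -> R[i].

Lemma cmod_measurable f : cmeasurable f ->
  measurable_fun setT (fun x => Normc.normc (f x)).
Proof.
move=> [mre mim].
rewrite (_ : (fun x => _) =
    fun x => ((complex.Re (f x)) ^+ 2 + (complex.Im (f x)) ^+ 2) `^ 2^-1).
  apply: (measurableT_comp (measurable_powR 2^-1)).
  by apply: measurable_funD; exact: measurable_funX.
apply/funext => x; case: (f x) => u v /=.
by rewrite powR12_sqrt// addr_ge0// sqr_ge0.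
Qed.

Lemma normc_ge0 (z : R[i]) : 0 <= Normc.normc z.
Proof. by case: z => u v; exact: sqrtr_ge0. Qed.

(** Nonnegative functions are the moduli of complex-valued functions. *)
Lemma cmod_real (g : borelRV R n -> R) : (forall x, 0 <= g x) ->
  cmod (fun x => Complex (g x) 0) = (fun x => (g x)%:E).
Proof.
move=> g0; apply/funext => x; rewrite /cmod /= expr0n/= addr0.
by rewrite sqrtr_sqr ger0_norm.
Qed.

Lemma cmeasurable_real (g : borelRV R n -> R) : measurable_fun setT g ->
  cmeasurable (fun x => Complex (g x) 0).
Proof. by move=> mg; split => /=. Qed.

Lemma homogeneous_dim_gt0 (G : homogeneousGroup R n) : (0 < n)%N ->
  0 < homogeneous_dim G.
Proof.
move=> n0; rewrite /homogeneous_dim (bigD1 (Ordinal n0))//=.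
rewrite ltr_pwDl ?hweight_gt0// sumr_ge0// => i _.
by rewrite ltW// hweight_gt0.
Qed.

End complex_functions.

Theorem corollary5p1 (R : realType) (n : nat) (n_gt0 : (0 < n)%N)
    (G : homogeneousGroup R n)
    (N : 'rV[R]_n -> R) (N_quasinorm : is_quasinorm G N)
    (mu : {measure set (borelRV R n) -> \bar R}) (mu_haar : is_haar G mu)
    (p1 p2 p1' p2' q alpha beta1 beta2 : R)
    (p1_gt1 : 1 < p1) (p2_gt1 : 1 < p2)
    (p1_conj : p1^-1 + p1'^-1 = 1) (p2_conj : p2^-1 + p2'^-1 = 1)
    (q_ge : 1 < Num.max p1 p2 <= q) :
  (exists C : R, forall f1 f2 : borelRV R n -> R[i],
     cmeasurable f1 -> cmeasurable f2 ->
     ((\int[mu]_x ((H2B N mu (cmod f1) (cmod f2) x) `^ q * (N x `^ alpha)%:E))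
        `^ q^-1
      <= C%:E
         * (\int[mu]_x ((cmod f1 x) `^ p1 * (N x `^ beta1)%:E)) `^ p1^-1
         * (\int[mu]_x ((cmod f2 x) `^ p2 * (N x `^ beta2)%:E)) `^ p2^-1)%E)
  <->
  ([/\ alpha + homogeneous_dim G < 0,
       0 < beta1 * (1 - p1') + homogeneous_dim G &
       0 < beta2 * (1 - p2') + homogeneous_dim G] /\
   (alpha + homogeneous_dim G) / q
     + (beta1 * (1 - p1') + homogeneous_dim G) / p1'
     + (beta2 * (1 - p2') + homogeneous_dim G) / p2' = 0).
Proof.
have Q0 := homogeneous_dim_gt0 G n_gt0.
have [a [b [a0 b0 vol]]] := quasiball_volume N_quasinorm mu_haar.
have mN := quasinorm_borel N_quasinorm.
have N0 := quasinorm_ge0 N_quasinorm.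
have /andP[] := q_ge; rewrite ge_max => max_gt1 /andP[p1q _].
have q0 : 0 < q by rewrite (lt_le_trans _ p1q)// (lt_trans _ p1_gt1).
split=> [[C H]|[[_ b1 b2] bal]].
  have hardy : bilinear_hardy mu N p1 p2 q alpha beta1 beta2 C.
    move=> f1 f2 mf1 mf2 f10 f20.
    have := H _ _ (cmeasurable_real mf1) (cmeasurable_real mf2).
    by rewrite !cmod_real.
  by have [[? ? ?] bal] := hardy_necessary mN N0 Q0 a0 b0 vol p1_gt1 p2_gt1 q0
    p1_conj p2_conj hardy.
have [C hardy] := hardy_sufficient mN N0 Q0 b0 vol p1_gt1 p2_gt1
  p1_conj p2_conj p1q b1 b2 bal.
exists C => f1 f2 mf1 mf2.
exact: hardy (cmod_measurable mf1) (cmod_measurable mf2)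
  (fun x => normc_ge0 (f1 x)) (fun x => normc_ge0 (f2 x)).
Qed.
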